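(* Let $k$ be a commutative artinian ring and let $(\mathcal C,\mathbb E,\mathfrak s)$ be an $\mathrm{Ext}$-finite, Krull-Schmidt, $k$-linear $n$-exangulated category. The two functors $\tau_n\colon\underline{\mathcal C_r}\to\overline{\mathcal C_l}$ and $\tau_n^-\colon\overline{\mathcal C_l}\to\underline{\mathcal C_r}$ are equivalences. Moreover, $\tau_n$ and $\tau_n^-$ are quasi-inverse to each other.
   Context: **$n$-exangulated categories.** Fix an integer $n\ge 1$. Let $\mathcal C$ be an additive category and $\mathbb E\colon\mathcal C^{\mathrm{op}}\times\mathcal C\to\mathrm{Ab}$ an additive bifunctor. An element $\delta\in\mathbb E(C,A)$ is an extension; for $a\colon A\to A'$, $c\colon C'\to C$ write $a_*\delta=\mathbb E(C,a)(\delta)$, $c^*\delta=\mathbb E(c,A)(\delta)$. A morphism of extensions from $\delta\in\mathbb E(C,A)$ to $\delta'\in\mathbb E(C',A')$ is a pair $(a\colon A\to A',\,c\colon C\to C')$ with $a_*\delta=c^*\delta'$. Consider complexes $X_\bullet\colon X_0\xrightarrow{d^X_0}X_1\to\cdots\to X_n\xrightarrow{d^X_n}X_{n+1}$ with chain maps $f_\bullet=(f_0,\dots,f_{n+1})$; for fixed end terms $X_0=A$, $X_{n+1}=C$, $[X_\bullet]$ denotes the homotopy equivalence class with respect to chain maps that are identities on both end terms. An $n$-exangle is a pair $\langle X_\bullet,\delta\rangle$ with $\delta\in\mathbb E(X_{n+1},X_0)$ such that the sequences of functors $\mathcal C(-,X_0)\to\cdots\to\mathcal C(-,X_{n+1})\to\mathbb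 E(-,X_0)$ (last map $f\mapsto f^*\delta$) and $\mathcal C(X_{n+1},-)\to\cdots\to\mathcal C(X_0,-)\to\mathbb E(X_{n+1},-)$ (last map $g\mapsto g_*\delta$) are exact. An exact realization $\mathfrak s$ assigns to each $\delta\in\mathbb E(C,A)$ a class $\mathfrak s(\delta)=[X_\bullet]$ with $X_0=A$, $X_{n+1}=C$ such that: (R0) if $\mathfrak s(\delta)=[X_\bullet]$, $\mathfrak s(\rho)=[Y_\bullet]$, each morphism of extensions $(a,c)\colon\delta\to\rho$ has a lift, i.e. a chain map $f_\bullet\colon X_\bullet\to Y_\bullet$ with $f_0=a$, $f_{n+1}=c$; (R1) if $\mathfrak s(\delta)=[X_\bullet]$ then $\langle X_\bullet,\delta\rangle$ is an $n$-exangle; (R2) $\mathfrak s$ of $0\in\mathbb E(0,A)$ is $[A\xrightarrow{\mathrm{id}}A\to0\to\cdots\to0]$ and of $0\in\mathbb E(A,0)$ is $[0\to\cdots\to0\to A\xrightarrow{\mathrm{id}}A]$. If $\mathfrak s(\delta)=[X_\bullet]$, then $\langle X_\bullet,\delta\rangle$ is a distinguished $n$-exangle, $d_0^X$ is an inflation and $d_n^X$ is a deflation. The mapping cone $M^f_\bullet$ of $f_\bullet\colon X_\bullet\to Y_\bullet$ with $f_0=\mathrm{id}$ is $X_1\to X_2\oplus Y_1\to\cdots\to X_{n+1}\oplus Y_n\to Y_{n+1}$ with differentials $\begin{bmatrix}-d_1^X\\ f_1\end{bmatrix}$, $\begin{bmatrix}-d^X_{i+1}&0\\ f_{i+1}&d_i^Y\end{bmatrix}$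 ($1\le i\le n-1$), $\begin{bmatrix}f_{n+1}&d_n^Y\end{bmatrix}$; mapping cocones of chain maps with $f_{n+1}=\mathrm{id}$ are defined dually. $(\mathcal C,\mathbb E,\mathfrak s)$ is $n$-exangulated if: (EA1) compositions of inflations are inflations and compositions of deflations are deflations; (EA2) for $\rho\in\mathbb E(D,A)$, $c\colon C\to D$ and distinguished $\langle X_\bullet,c^*\rho\rangle$, $\langle Y_\bullet,\rho\rangle$, the pair $(\mathrm{id}_A,c)$ has a lift $f_\bullet$ such that $\langle M^f_\bullet,(d_0^X)_*\rho\rangle$ is distinguished; (EA2$^{\mathrm{op}}$) the dual of (EA2). **Standing assumptions.** $k$-linear: $\mathcal C$ is $k$-linear and $\mathbb E$ is $k$-bilinear. $\mathrm{Ext}$-finite: every $\mathbb E(A,B)$ is a finitely generated $k$-module. **Stable categories.** A morphism $f\colon X\to Y$ is $n$-projectively trivial if $\mathbb E(f,Z)\colon\mathbb E(Y,Z)\to\mathbb E(X,Z)$ is zero for all $Z$, and $n$-injectively trivial if $\mathbb E(Z,f)\colon\mathbb E(Z,X)\to\mathbb E(Z,Y)$ is zero for all $Z$. $\mathcal P(A,B)$ (resp. $\mathcal I(A,B)$) is the set of $n$-projectively (resp. $n$-injectively) trivial morphisms $A\to B$. The stable category $\underline{\mathcal C}$ and costable category $\overline{\mathcal C}$ have the objects of $\mathcal C$ and morphisms $\underline{\mathcal C}(A,B)=\mathcal C(A,B)/\mathcal P(A,B)$, $\overline{\mathcal C}(A,B)=\mathcal C(A,B)/\mathcal I(A,B)$.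 Let $D=\mathrm{Hom}_k(-,\check k)$ with $\check k$ the minimal injective cogenerator of the category $k$-mod of finitely generated $k$-modules. **The subcategories and functors.** $\mathcal C_r$ (resp. $\mathcal C_l$) is the full subcategory of those $X\in\mathcal C$ for which $D\mathbb E(X,-)\colon\overline{\mathcal C}\to k\text{-mod}$ (contravariant) (resp. $D\mathbb E(-,X)\colon\underline{\mathcal C}\to k\text{-mod}$ (covariant)) is representable. $\underline{\mathcal C_r}$ is the image of $\mathcal C_r$ in $\underline{\mathcal C}$ and $\overline{\mathcal C_l}$ is the image of $\mathcal C_l$ in $\overline{\mathcal C}$ (full subcategories). For each $X\in\mathcal C_r$ fix an object $\tau_nX$ and an isomorphism of functors $\phi_{X,-}\colon\overline{\mathcal C}(-,\tau_nX)\to D\mathbb E(X,-)$; for each $Y\in\mathcal C_l$ fix an object $\tau_n^-Y$ and an isomorphism of functors $\psi_{-,Y}\colon\underline{\mathcal C}(\tau_n^-Y,-)\to D\mathbb E(-,Y)$. One has $\tau_nX\in\mathcal C_l$ and $\tau_n^-Y\in\mathcal C_r$. For $f\colon X\to M$ in $\mathcal C_r$, $\tau_n(f)\in\overline{\mathcal C}(\tau_nX,\tau_nM)$ is the unique morphism with $\phi_{M,-}\circ\overline{\mathcal C}(-,\tau_n(f))=D\mathbb E(f,-)\circ\phi_{X,-}$; it depends only on the class $\underline f$, and this defines the functor $\tau_n\colon\underline{\mathcal C_r}\to\overline{\mathcal C_l}$. For $\overline g\colon Y\to N$ in $\overline{\mathcal C_l}$, $\tau_n^-(\overline g)\in\underline{\mathcal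 C}(\tau_n^-Y,\tau_n^-N)$ is the unique morphism with $\psi_{-,Y}\circ\underline{\mathcal C}(\tau_n^-(\overline g),-)=D\mathbb E(-,g)\circ\psi_{-,N}$; this defines the functor $\tau_n^-\colon\overline{\mathcal C_l}\to\underline{\mathcal C_r}$. *)

(* Defs.v *)
From HB Require Import structures.
From mathcomp Require Import all_boot all_order all_algebra.
From mathcomp Require Import generic_quotient ring_quotient.
From mathcomp Require Import boolp.

Set Implicit Arguments.
Unset Strict Implicit.
Unset Printing Implicit Defensive.

Import GRing.Theory.
Local Open Scope ring_scope.
Local Open Scope quotient_scope.

Definition is_ideal (k : comPzRingType) (I : k -> Prop) : Prop :=
  [/\ I 0, forall x y, I x -> I y -> I (x + y) & forall a x, I x -> I (a * x)].

Definition artinian (k : comPzRingType) : Prop :=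
  forall I : nat -> k -> Prop,
    (forall i, is_ideal (I i)) -> (forall i x, I i.+1 x -> I i x) ->
    exists N, forall i, (N <= i)%N -> forall x, I N x -> I i x.

Section Modules.
Variable k : comPzRingType.

Definition fin_gen (M : lmodType k) : Prop :=
  exists (m : nat) (e : 'I_m -> M), forall x, exists c : 'I_m -> k,
    x = \sum_(i < m) c i *: e i.

Definition injective_in_kmod (Q : lmodType k) : Prop :=
  forall (M N : lmodType k), fin_gen M -> fin_gen N ->
  forall (i : {linear M -> N}) (f : {linear M -> Q}), injective i ->
  exists g : {linear N -> Q}, forall x, g (i x) = f x.

Definition cogenerator_of_kmod (Q : lmodType k) : Prop :=
  forall (M N : lmodType k), fin_gen M -> fin_gen N ->
  forall f g : {linear M -> N},
    (forall h : {linear N -> Q}, h \o f =1 h \o g) -> f =1 g.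

Definition inj_cogenerator (Q : lmodType k) : Prop :=
  [/\ fin_gen Q, injective_in_kmod Q & cogenerator_of_kmod Q].

(* Minimality: it embeds in every injective cogenerator of k-mod (necessarily
   as a direct summand, by injectivity). *)
Definition minimal_inj_cogenerator (Q : lmodType k) : Prop :=
  inj_cogenerator Q /\
  forall Q' : lmodType k, inj_cogenerator Q' ->
    exists i : {linear Q -> Q'}, injective i.

End Modules.

Section QuotientModule.
Variables (k : pzRingType) (V : lmodType k) (S : submodClosed V).

(* The library derives closure under opposites for an lmodType, but does not
   register S as a zmodClosed, which its quotient construction takes. *)
Definition zmod_of_submod : {pred V} := fun x => x \in S.

Let zmod_of_submodP : zmod_closed zmod_of_submod.
Proof.
split=> [|x y xS yS]; first exact: (rpred0 S).
by apply: (rpredD (S := S)) => //; rewrite -scaleN1r; apply: (rpredZ (s := S)).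
Qed.

HB.instance Definition _ := GRing.isZmodClosed.Build V zmod_of_submod
  zmod_of_submodP.

Definition quotmod := Quotient.quot zmod_of_submod.

HB.instance Definition _ := GRing.Zmodule.on quotmod.

Definition qclass (x : V) : quotmod := \pi_(Quotient.quot zmod_of_submod) x.

Lemma qclassP (x y : V) : (qclass x = qclass y) <-> (x - y \in S).
Proof. by rewrite -[x - y \in S]/(x - y \in zmod_of_submod) Quotient.idealrBE; split=> [/eqP|/eqP]. Qed.

Lemma qclass_repr (x : quotmod) : qclass (repr x) = x.
Proof. exact: reprK. Qed.

Lemma qclass_ind (P : quotmod -> Prop) :
  (forall x, P (qclass x)) -> forall x, P x.
Proof. by move=> h x; rewrite -(qclass_repr x). Qed.

Lemma qclassD x y : qclass (x + y) = qclass x + qclass y.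
Proof. exact: (Quotient.pi_add zmod_of_submod). Qed.

Definition qscale (a : k) (x : quotmod) : quotmod := qclass (a *: repr x).

Lemma qclassZ a x : qclass (a *: x) = qscale a (qclass x).
Proof.
by apply/qclassP; rewrite -scalerBr rpredZ//; apply/qclassP; rewrite qclass_repr.
Qed.

Let qscaleA a b x : qscale a (qscale b x) = qscale (a * b) x.
Proof. by elim/qclass_ind: x => x; rewrite -!qclassZ scalerA. Qed.

Let qscale1 : left_id 1 qscale.
Proof. by elim/qclass_ind => x; rewrite -qclassZ scale1r. Qed.

Let qscaleDr : right_distributive qscale +%R.
Proof.
move=> a; elim/qclass_ind => x; elim/qclass_ind => y.
by rewrite -qclassD -!qclassZ -qclassD scalerDr.
Qed.

Let qscaleDl x : {morph qscale^~ x : a b / a + b}.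
Proof.
by move=> a b; elim/qclass_ind: x => x; rewrite -!qclassZ -qclassD scalerDl.
Qed.

HB.instance Definition _ := GRing.Zmodule_isLmodule.Build k quotmod
  qscaleA qscale1 qscaleDr qscaleDl.

Lemma qclass_linear : linear qclass.
Proof. by move=> a x y; rewrite qclassD qclassZ. Qed.

HB.instance Definition _ :=
  GRing.isLinear.Build k V quotmod _ qclass qclass_linear.

End QuotientModule.

Section Dual.
Variables (k : comPzRingType) (kc M : lmodType k).

Definition dual : Type := {linear M -> kc}.

HB.instance Definition _ := gen_eqMixin dual.
HB.instance Definition _ := gen_choiceMixin dual.

Lemma dualP (f g : dual) : f =1 g -> f = g.
Proof.
case: f g => f [[a1] [a2]] [g [[b1] [b2]]] /= /funext efg.
by subst g; congr GRing.Linear.Pack; congr GRing.Linear.Class;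
  congr (_ _); exact: Prop_irrelevance.
Qed.

Definition dual0 : dual := \0.
Definition dualN (f : dual) : dual := \- f.
Definition dualD (f g : dual) : dual := f \+ g.
Definition dualZ (a : k) (f : dual) : dual := a \*: f.

Let dualDA : associative dualD.
Proof. by move=> f g h; apply: dualP => x /=; rewrite addrA. Qed.
Let dualDC : commutative dualD.
Proof. by move=> f g; apply: dualP => x /=; rewrite addrC. Qed.
Let dual0D : left_id dual0 dualD.
Proof. by move=> f; apply: dualP => x /=; rewrite add0r. Qed.
Let dualND : left_inverse dual0 dualN dualD.
Proof. by move=> f; apply: dualP => x /=; rewrite addNr. Qed.

HB.instance Definition _ := GRing.isZmodule.Build dual dualDA dualDC dual0D dualND.

Let dualZA a b f : dualZ a (dualZ b f) = dualZ (a * b) f.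
Proof. by apply: dualP => x /=; rewrite scalerA. Qed.
Let dualZ1 : left_id 1 dualZ.
Proof. by move=> f; apply: dualP => x /=; rewrite scale1r. Qed.
Let dualZDr : right_distributive dualZ +%R.
Proof. by move=> a f g; apply: dualP => x /=; rewrite scalerDr. Qed.
Let dualZDl f : {morph dualZ^~ f : a b / a + b}.
Proof. by move=> a b; apply: dualP => x /=; rewrite scalerDl. Qed.

HB.instance Definition _ := GRing.Zmodule_isLmodule.Build k dual
  dualZA dualZ1 dualZDr dualZDl.

End Dual.

Definition dual_map (k : comPzRingType) (kc M N : lmodType k)
  (f : {linear M -> N}) (u : dual kc N) : dual kc M := u \o f.

Record category := Category {
  obj : Type;
  mor : obj -> obj -> Type;
  cat_id : forall A, mor A A;
  cat_comp : forall A B C, mor B C -> mor A B -> mor A C;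
  cat_compA : forall A B C D (h : mor C D) (g : mor B C) (f : mor A B),
    cat_comp h (cat_comp g f) = cat_comp (cat_comp h g) f;
  cat_idl : forall A B (f : mor A B), cat_comp (cat_id B) f = f;
  cat_idr : forall A B (f : mor A B), cat_comp f (cat_id A) = f
}.
Arguments cat_id {c} A.
Arguments cat_comp {c A B C} _ _.

Definition full_sub (K : category) (P : obj K -> Prop) : category :=
  @Category {X : obj K | P X} (fun X Y => mor (sval X) (sval Y))
    (fun X => cat_id (sval X)) (fun _ _ _ g f => cat_comp g f)
    (fun _ _ _ _ h g f => cat_compA h g f)
    (fun _ _ f => cat_idl f) (fun _ _ f => cat_idr f).

Record functor (K L : category) := Functor {
  fobj :> obj K -> obj L;
  fmor : forall A B, mor A B -> mor (fobj A) (fobj B);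
  fmor_id : forall A, fmor (cat_id A) = cat_id (fobj A);
  fmor_comp : forall A B C (g : mor B C) (f : mor A B),
    fmor (cat_comp g f) = cat_comp (fmor g) (fmor f)
}.

Definition functor_id (K : category) : functor K K :=
  @Functor K K id (fun _ _ f => f) (fun _ => erefl) (fun _ _ _ _ _ => erefl).

Section FunctorComp.
Variables (K L M : category) (G : functor L M) (F : functor K L).

Let GF_id A : fmor G (fmor F (cat_id A)) = cat_id (G (F A)).
Proof. by rewrite !fmor_id. Qed.

Let GF_comp A B C (g : mor B C) (f : mor A B) :
  fmor G (fmor F (cat_comp g f))
  = cat_comp (fmor G (fmor F g)) (fmor G (fmor F f)).
Proof. by rewrite !fmor_comp. Qed.

Definition functor_comp : functor K M :=
  @Functor K M (fun A => G (F A)) (fun _ _ f => fmor G (fmor F f)) GF_id GF_comp.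

End FunctorComp.

Definition cat_iso (K : category) (A B : obj K) (f : mor A B) : Prop :=
  exists g : mor B A, cat_comp g f = cat_id A /\ cat_comp f g = cat_id B.

Definition nat_isomorphic (K L : category) (F G : functor K L) : Prop :=
  exists eta : forall A, mor (F A) (G A),
    (forall A, cat_iso (eta A)) /\
    (forall A B (f : mor A B),
       cat_comp (eta B) (fmor F f) = cat_comp (fmor G f) (eta A)).

Definition quasi_inverse (K L : category) (F : functor K L) (G : functor L K) :=
  nat_isomorphic (functor_comp G F) (functor_id K) /\
  nat_isomorphic (functor_comp F G) (functor_id L).

Definition equivalence (K L : category) (F : functor K L) : Prop :=
  exists G : functor L K, quasi_inverse F G.

Record linCat (k : comPzRingType) := LinCat {
  ob :> Type;
  Hom : ob -> ob -> lmodType k;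
  idm : forall A, Hom A A;
  comp : forall A B C, Hom B C -> Hom A B -> Hom A C;
  compA : forall A B C D (h : Hom C D) (g : Hom B C) (f : Hom A B),
    comp h (comp g f) = comp (comp h g) f;
  comp1m : forall A B (f : Hom A B), comp (idm B) f = f;
  compm1 : forall A B (f : Hom A B), comp f (idm A) = f;
  comp_linl : forall A B C a (g g' : Hom B C) (f : Hom A B),
    comp (a *: g + g') f = a *: comp g f + comp g' f;
  comp_linr : forall A B C a (g : Hom B C) (f f' : Hom A B),
    comp g (a *: f + f') = a *: comp g f + comp g f';
  ozero : ob;
  ozeroE : idm ozero = 0;
  osum : ob -> ob -> ob;
  inl_ : forall A B, Hom A (osum A B);
  inr_ : forall A B, Hom B (osum A B);
  prl_ : forall A B, Hom (osum A B) A;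
  prr_ : forall A B, Hom (osum A B) B;
  prl_inl : forall A B, comp (prl_ A B) (inl_ A B) = idm A;
  prr_inr : forall A B, comp (prr_ A B) (inr_ A B) = idm B;
  prl_inr : forall A B, comp (prl_ A B) (inr_ A B) = 0;
  prr_inl : forall A B, comp (prr_ A B) (inl_ A B) = 0;
  osumE : forall A B, comp (inl_ A B) (prl_ A B) + comp (inr_ A B) (prr_ A B)
                      = idm (osum A B)
}.
Arguments Hom {k l} A B.
Arguments idm {k l} A.
Arguments comp {k l A B C} _ _.
Arguments osum {k l} A B.
Arguments inl_ {k l} A B.
Arguments inr_ {k l} A B.
Arguments prl_ {k l} A B.
Arguments prr_ {k l} A B.

Notation "g \com f" := (comp g f) (at level 40, left associativity) : ring_scope.

Section LinCatTheory.
Variables (k : comPzRingType) (C : linCat k).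

Lemma compDl A B D (g g' : Hom B D) (f : @Hom k C A B) :
  (g + g') \com f = g \com f + g' \com f.
Proof. by have := comp_linl 1 g g' f; rewrite !scale1r. Qed.

Lemma compDr A B D (g : Hom B D) (f f' : @Hom k C A B) :
  g \com (f + f') = g \com f + g \com f'.
Proof. by have := comp_linr 1 g f f'; rewrite !scale1r. Qed.

Lemma comp0m A B D (f : @Hom k C A B) : (0 : Hom B D) \com f = 0.
Proof. by apply: (addrI ((0 : Hom B D) \com f)); rewrite -compDl !addr0. Qed.

Lemma compm0 A B D (g : @Hom k C B D) : g \com (0 : Hom A B) = 0.
Proof. by apply: (addrI (g \com (0 : Hom A B))); rewrite -compDr !addr0. Qed.

Lemma compNm A B D (g : Hom B D) (f : @Hom k C A B) : (- g) \com f = - (g \com f).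
Proof. by apply: (addrI (g \com f)); rewrite -compDl !subrr comp0m. Qed.

Lemma compmN A B D (g : Hom B D) (f : @Hom k C A B) : g \com (- f) = - (g \com f).
Proof. by apply: (addrI (g \com f)); rewrite -compDr !subrr compm0. Qed.

Lemma compZl A B D a (g : Hom B D) (f : @Hom k C A B) :
  (a *: g) \com f = a *: (g \com f).
Proof. by have := comp_linl a g 0 f; rewrite comp0m !addr0. Qed.

Lemma compZr A B D a (g : Hom B D) (f : @Hom k C A B) :
  g \com (a *: f) = a *: (g \com f).
Proof. by have := comp_linr a g f 0; rewrite compm0 !addr0. Qed.

(* The identity of an object, seen between two equal objects. *)
Definition eq_hom (A B : C) (e : A = B) : Hom A B :=
  match e in _ = B' return Hom A B' with erefl => idm A end.

Lemma eq_homK (A B : C) (e : A = B) : eq_hom (esym e) \com eq_hom e = idm A.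
Proof. by case: B / e; rewrite comp1m. Qed.

Lemma eq_homVK (A B : C) (e : A = B) : eq_hom e \com eq_hom (esym e) = idm B.
Proof. by case: B / e; rewrite comp1m. Qed.

Definition is_iso (A B : C) (f : Hom A B) : Prop :=
  exists g : Hom B A, g \com f = idm A /\ f \com g = idm B.

Definition local_end (X : C) : Prop :=
  idm X <> 0 /\
  forall f g : Hom X X, ~ is_iso f -> ~ is_iso g -> ~ is_iso (f + g).

Definition is_direct_sum (X : C) (m : nat) (Y : 'I_m -> C) : Prop :=
  exists (i : forall j, Hom (Y j) X) (p : forall j, Hom X (Y j)),
    [/\ forall j, p j \com i j = idm (Y j),
        forall j l, j != l -> p l \com i j = 0
      & \sum_j i j \com p j = idm X].

End LinCatTheory.

Definition krull_schmidt (k : comPzRingType) (C : linCat k) : Prop :=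
  forall X : C, exists (m : nat) (Y : 'I_m -> C),
    is_direct_sum X Y /\ forall j, local_end (Y j).

(* [E C A] is the module of extensions; [push a] is a_* and [pull c] is c^*. *)
Record bifunctor (k : comPzRingType) (K : linCat k) := Bifunctor {
  Ext :> K -> K -> lmodType k;
  push : forall C A A', Hom A A' -> {linear Ext C A -> Ext C A'};
  pull : forall C C' A, Hom C' C -> {linear Ext C A -> Ext C' A};
  push1 : forall C A (d : Ext C A), push C (idm A) d = d;
  pull1 : forall C A (d : Ext C A), pull A (idm C) d = d;
  push_comp : forall C A A' A'' (b : Hom A' A'') (a : Hom A A') (d : Ext C A),
    push C (b \com a) d = push C b (push C a d);
  pull_comp : forall C C' C'' A (c : Hom C' C) (b : Hom C'' C') (d : Ext C A),
    pull A (c \com b) d = pull A b (pull A c d);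
  push_pull : forall C C' A A' (a : Hom A A') (c : Hom C' C) (d : Ext C A),
    push C' a (pull A c d) = pull A' c (push C a d);
  push_lin : forall C A A' x (a b : Hom A A') (d : Ext C A),
    push C (x *: a + b) d = x *: push C a d + push C b d;
  pull_lin : forall C C' A x (c b : Hom C' C) (d : Ext C A),
    pull A (x *: c + b) d = x *: pull A c d + pull A b d
}.
Arguments push {k K} E {C A A'} a : rename.
Arguments pull {k K} E {C C' A} c : rename.

Definition Ext_finite (k : comPzRingType) (K : linCat k) (E : bifunctor K) :=
  forall A B : K, fin_gen (E A B).

Section Complexes.
Variables (k : comPzRingType) (K : linCat k) (n : nat).

(* A complex with end terms X_0 = A and X_{n+1} = C. Terms and differentials are
   indexed by all natural numbers, but only X_0, ..., X_{n+1} and d_0, ..., d_n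
   are meaningful: nothing below depends on the others. *)
Record cpx (A C : K) := Cpx {
  term :> nat -> K;
  diff : forall i, Hom (term i) (term i.+1);
  diffK : forall i, (i < n)%N -> diff i.+1 \com diff i = 0;
  term_first : term 0 = A;
  term_last : term n.+1 = C
}.
Arguments diff {A C} c i.
Arguments diffK {A C} c {i} _.
Arguments term_first {A C} c.
Arguments term_last {A C} c.

Definition first_diff A C (X : cpx A C) : Hom A (X 1) :=
  diff X 0 \com eq_hom (esym (term_first X)).

Definition last_diff A C (X : cpx A C) : Hom (X n) C :=
  eq_hom (term_last X) \com diff X n.

Record chain_map A C A' C' (X : cpx A C) (Y : cpx A' C') := ChainMap {
  cmap :> forall i, Hom (X i) (Y i);
  cmapE : forall i, (i <= n)%N -> cmap i.+1 \com diff X i = diff Y i \com cmap i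
}.

Definition is_lift A C A' C' (X : cpx A C) (Y : cpx A' C')
    (f : forall i, Hom (X i) (Y i)) (a : Hom A A') (c : Hom C C') : Prop :=
  eq_hom (term_first Y) \com f 0%N = a \com eq_hom (term_first X) /\
  eq_hom (term_last Y) \com f n.+1 = c \com eq_hom (term_last X).

Definition homotopic A C A' C' (X : cpx A C) (Y : cpx A' C')
    (f g : forall i, Hom (X i) (Y i)) : Prop :=
  exists h : forall i, Hom (X i.+1) (Y i),
    [/\ f 0%N - g 0%N = h 0%N \com diff X 0,
        forall i, (i < n)%N ->
          f i.+1 - g i.+1 = diff Y i \com h i + h i.+1 \com diff X i.+1
      & f n.+1 - g n.+1 = diff Y n \com h n].

Definition homotopy_equivalent A C (X Y : cpx A C) : Prop :=
  exists (f : chain_map X Y) (g : chain_map Y X),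
    [/\ is_lift f (idm A) (idm C), is_lift g (idm A) (idm C),
        homotopic (fun i => g i \com f i) (fun i => idm (X i))
      & homotopic (fun i => f i \com g i) (fun i => idm (Y i))].

(* The cone of f is X_1 -> X_2 (+) Y_1 -> ... -> X_{n+1} (+) Y_n -> Y_{n+1}. Its
   term of index j+1 is X_{j+2} (+) Y_{j+1} for j < n and Y_{n+1} for j = n; the
   structure maps of this direct sum are extended by 0 and id to the case j = n,
   so that one formula gives all the differentials. *)
Section Cone.
Variables (A C A' C' : K) (X : cpx A C) (Y : cpx A' C') (f : chain_map X Y).

Definition cone_sum (j : nat) (b : bool) : K :=
  if b then osum (X j.+2) (Y j.+1) else Y j.+1.
Definition cone_term (i : nat) : K :=
  if i is j.+1 then cone_sum j (j < n)%N else X 1.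

Definition cone_inX j b : Hom (X j.+2) (cone_sum j b) :=
  if b return Hom (X j.+2) (cone_sum j b) then inl_ _ _ else 0.
Definition cone_inY j b : Hom (Y j.+1) (cone_sum j b) :=
  if b return Hom (Y j.+1) (cone_sum j b) then inr_ _ _ else idm _.
Definition cone_prX j b : Hom (cone_sum j b) (X j.+2) :=
  if b return Hom (cone_sum j b) (X j.+2) then prl_ _ _ else 0.
Definition cone_prY j b : Hom (cone_sum j b) (Y j.+1) :=
  if b return Hom (cone_sum j b) (Y j.+1) then prr_ _ _ else idm _.

Definition cone_diff (i : nat) : Hom (cone_term i) (cone_term i.+1) :=
  match i return Hom (cone_term i) (cone_term i.+1) with
  | 0 => - (cone_inX 0 (0 < n)%N \com diff X 1) + cone_inY 0 (0 < n)%N \com f 1%N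
  | j.+1 =>
      - (cone_inX j.+1 (j.+1 < n)%N \com diff X j.+2 \com cone_prX j (j < n)%N)
      + cone_inY j.+1 (j.+1 < n)%N \com f j.+2 \com cone_prX j (j < n)%N
      + cone_inY j.+1 (j.+1 < n)%N \com diff Y j.+1 \com cone_prY j (j < n)%N
  end.

Let prX_inX j : (j < n)%N -> cone_prX j (j < n)%N \com cone_inX j (j < n)%N = idm _.
Proof. by move=> ->; exact: prl_inl. Qed.
Let prY_inY j : (j < n)%N -> cone_prY j (j < n)%N \com cone_inY j (j < n)%N = idm _.
Proof. by move=> ->; exact: prr_inr. Qed.
Let prX_inY j : (j < n)%N -> cone_prX j (j < n)%N \com cone_inY j (j < n)%N = 0.
Proof. by move=> ->; exact: prl_inr. Qed.
Let prY_inX j : (j < n)%N -> cone_prY j (j < n)%N \com cone_inX j (j < n)%N = 0.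
Proof. by move=> ->; exact: prr_inl. Qed.
Let inX_diffK j : cone_inX j (j < n)%N \com diff X j.+1 \com diff X j = 0.
Proof.
case: ltnP => jn; last by rewrite /cone_inX !comp0m.
by rewrite -compA diffK ?compm0.
Qed.

Let diff_inX j : (j < n)%N ->
  cone_diff j.+1 \com cone_inX j (j < n)%N
  = cone_inY j.+1 (j.+1 < n)%N \com f j.+2
    - cone_inX j.+1 (j.+1 < n)%N \com diff X j.+2.
Proof.
move=> jn; rewrite /cone_diff !compDl !compNm -!(compA _ _ (cone_inX _ _)).
by rewrite prX_inX// prY_inX// !compm1 compm0 addr0 addrC.
Qed.
Let diff_inY j : (j < n)%N ->
  cone_diff j.+1 \com cone_inY j (j < n)%N
  = cone_inY j.+1 (j.+1 < n)%N \com diff Y j.+1.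
Proof.
move=> jn; rewrite /cone_diff !compDl !compNm -!(compA _ _ (cone_inY _ _)).
by rewrite prX_inY// prY_inY// !compm1 !compm0 oppr0 !add0r.
Qed.

Lemma cone_diffK i : (i < n)%N -> cone_diff i.+1 \com cone_diff i = 0.
Proof.
case: i => [|j] jn; rewrite {2}/cone_diff !compDr !compmN !compA.
  rewrite diff_inX// diff_inY// !compDl !compNm inX_diffK oppr0 addr0.
  by rewrite -(compA _ (f 2) (diff X 1)) cmapE// compA addNr.
rewrite diff_inX// diff_inY// !compDl !compNm inX_diffK comp0m oppr0 addr0.
rewrite -(compA _ (f j.+3) (diff X j.+2)) cmapE// (compA _ _ (f j.+2)).
rewrite addNr add0r -(compA _ (diff Y j.+2) (diff Y j.+1)) diffK//.
by rewrite compm0 comp0m.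
Qed.

Lemma cone_term_last : cone_term n.+1 = C'.
Proof. by rewrite /cone_term ltnn; exact: (term_last Y). Qed.

Definition cone : cpx (X 1) C' :=
  @Cpx (X 1) C' cone_term cone_diff cone_diffK erefl cone_term_last.

End Cone.

(* Dually, the cocone of f is X_0 -> Y_0 (+) X_1 -> ... -> Y_{n-1} (+) X_n -> Y_n,
   with differentials (f_0, d_0), ((-d, f), (0, d)) and (-d_{n-1}, f_n). *)
Section Cocone.
Variables (A C A' C' : K) (X : cpx A C) (Y : cpx A' C') (f : chain_map X Y).

Definition cocone_sum (j : nat) (b : bool) : K :=
  if b then osum (Y j) (X j.+1) else Y j.
Definition cocone_term (i : nat) : K :=
  if i is j.+1 then cocone_sum j (j < n)%N else X 0.

Definition cocone_inY j b : Hom (Y j) (cocone_sum j b) :=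
  if b return Hom (Y j) (cocone_sum j b) then inl_ _ _ else idm _.
Definition cocone_inX j b : Hom (X j.+1) (cocone_sum j b) :=
  if b return Hom (X j.+1) (cocone_sum j b) then inr_ _ _ else 0.
Definition cocone_prY j b : Hom (cocone_sum j b) (Y j) :=
  if b return Hom (cocone_sum j b) (Y j) then prl_ _ _ else idm _.
Definition cocone_prX j b : Hom (cocone_sum j b) (X j.+1) :=
  if b return Hom (cocone_sum j b) (X j.+1) then prr_ _ _ else 0.

Definition cocone_diff (i : nat) : Hom (cocone_term i) (cocone_term i.+1) :=
  match i return Hom (cocone_term i) (cocone_term i.+1) with
  | 0 => cocone_inY 0 (0 < n)%N \com f 0%N + cocone_inX 0 (0 < n)%N \com diff X 0
  | j.+1 =>
      - (cocone_inY j.+1 (j.+1 < n)%N \com diff Y j \com cocone_prY j (j < n)%N)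
      + cocone_inY j.+1 (j.+1 < n)%N \com f j.+1 \com cocone_prX j (j < n)%N
      + cocone_inX j.+1 (j.+1 < n)%N \com diff X j.+1 \com cocone_prX j (j < n)%N
  end.

Let prX_inX j : (j < n)%N ->
  cocone_prX j (j < n)%N \com cocone_inX j (j < n)%N = idm _.
Proof. by move=> ->; exact: prr_inr. Qed.
Let prY_inY j : (j < n)%N ->
  cocone_prY j (j < n)%N \com cocone_inY j (j < n)%N = idm _.
Proof. by move=> ->; exact: prl_inl. Qed.
Let prX_inY j : (j < n)%N ->
  cocone_prX j (j < n)%N \com cocone_inY j (j < n)%N = 0.
Proof. by move=> ->; exact: prr_inl. Qed.
Let prY_inX j : (j < n)%N ->
  cocone_prY j (j < n)%N \com cocone_inX j (j < n)%N = 0.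
Proof. by move=> ->; exact: prl_inr. Qed.

Let diff_inX j : (j < n)%N ->
  cocone_diff j.+1 \com cocone_inX j (j < n)%N
  = cocone_inY j.+1 (j.+1 < n)%N \com f j.+1
    + cocone_inX j.+1 (j.+1 < n)%N \com diff X j.+1.
Proof.
move=> jn; rewrite /cocone_diff !compDl !compNm -!(compA _ _ (cocone_inX _ _)).
by rewrite prX_inX// prY_inX// !compm1 compm0 oppr0 add0r.
Qed.
Let diff_inY j : (j < n)%N ->
  cocone_diff j.+1 \com cocone_inY j (j < n)%N
  = - (cocone_inY j.+1 (j.+1 < n)%N \com diff Y j).
Proof.
move=> jn; rewrite /cocone_diff !compDl !compNm -!(compA _ _ (cocone_inY _ _)).
by rewrite prX_inY// prY_inY// !compm1 !compm0 !addr0.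
Qed.

Lemma cocone_diffK i : (i < n)%N -> cocone_diff i.+1 \com cocone_diff i = 0.
Proof.
case: i => [|j] jn; rewrite {2}/cocone_diff !compDr ?compmN !compA.
  rewrite diff_inX// diff_inY// !compDl !compNm.
  rewrite -(compA _ (diff X 1) (diff X 0)) diffK// compm0 addr0.
  by rewrite -(compA _ (f 1%N) (diff X 0)) cmapE// compA addNr.
have jn' := ltnW jn.
rewrite diff_inX// diff_inY// !compDl !compNm.
rewrite -(compA _ (diff Y j.+1) (diff Y j)) diffK// compm0 comp0m !oppr0 add0r.
rewrite -(compA _ (diff X j.+2) (diff X j.+1)) diffK// compm0 comp0m addr0.
rewrite -(compA _ (f j.+2) (diff X j.+1)) cmapE// (compA _ _ (f j.+1)).
by rewrite addNr.
Qed.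

Lemma cocone_term_last : cocone_term n.+1 = Y n.
Proof. by rewrite /cocone_term ltnn. Qed.

Definition cocone : cpx A (Y n) :=
  @Cpx A (Y n) cocone_term cocone_diff cocone_diffK (term_first X) cocone_term_last.

End Cocone.

End Complexes.

Arguments diff {k K n A C} c i.
Arguments diffK {k K n A C} c {i} _.
Arguments term_first {k K n A C} c.
Arguments term_last {k K n A C} c.

Section Exangulated.
Variables (k : comPzRingType) (K : linCat k) (E : bifunctor K) (n : nat).

Definition is_exangle (A C : K) (X : cpx n A C) (d : E C A) : Prop :=
  [/\ forall (Z : K) i (g : Hom Z (X i.+1)), (i < n)%N ->
        diff X i.+1 \com g = 0 <-> exists h, g = diff X i \com h,
      forall (Z : K) (g : Hom Z C),
        pull E g d = 0 <-> exists h, g = last_diff X \com h,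
      forall (Z : K) i (g : Hom (X i.+1) Z), (i < n)%N ->
        g \com diff X i = 0 <-> exists h, g = h \com diff X i.+1
    & forall (Z : K) (g : Hom A Z),
        push E g d = 0 <-> exists h, g = h \com first_diff X].

(* A = A -> 0 -> ... -> 0 *)
Definition trivial_left (A : K) (X : cpx n A (ozero K)) : Prop :=
  (exists e : X 1 = A, eq_hom e \com first_diff X = idm A) /\
  forall i, (1 < i <= n)%N -> X i = ozero K.

(* 0 -> ... -> 0 -> A = A *)
Definition trivial_right (A : K) (X : cpx n (ozero K) A) : Prop :=
  (exists e : A = X n, last_diff X \com eq_hom e = idm A) /\
  forall i, (0 < i < n)%N -> X i = ozero K.

(* [real d] is the homotopy equivalence class s(d), as a predicate. *)
Record exact_realization := ExactRealization {
  real : forall A C, E C A -> cpx n A C -> Prop;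
  real_class : forall A C (d : E C A),
    exists X, forall Y, real d Y <-> homotopy_equivalent X Y;
  real_lift : forall A C A' C' (d : E C A) (r : E C' A')
      (X : cpx n A C) (Y : cpx n A' C') (a : Hom A A') (c : Hom C C'),
    real d X -> real r Y -> push E a d = pull E c r ->
    exists f : chain_map X Y, is_lift f a c;
  real_exangle : forall A C (d : E C A) (X : cpx n A C),
    real d X -> is_exangle X d;
  real_zero_left : forall A,
    exists X, trivial_left X /\ real (0 : E (ozero K) A) X;
  real_zero_right : forall A,
    exists X, trivial_right X /\ real (0 : E A (ozero K)) X
}.

Arguments real s {A C} d X : rename.

Variable s : exact_realization.

Definition inflation (A B : K) (f : Hom A B) : Prop :=
  exists (C : K) (d : E C A) (X : cpx n A C) (e : X 1 = B),
    real s d X /\ f = eq_hom e \com first_diff X.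

Definition deflation (B C : K) (f : Hom B C) : Prop :=
  exists (A : K) (d : E C A) (X : cpx n A C) (e : B = X n),
    real s d X /\ f = last_diff X \com eq_hom e.

Record n_exangulated : Prop := NExangulated {
  ea1_inflation : forall (A B D : K) (g : Hom B D) (f : Hom A B),
    inflation g -> inflation f -> inflation (g \com f);
  ea1_deflation : forall (A B D : K) (g : Hom B D) (f : Hom A B),
    deflation g -> deflation f -> deflation (g \com f);
  ea2 : forall (A C D : K) (r : E D A) (c : Hom C D)
      (X : cpx n A C) (Y : cpx n A D),
    real s (pull E c r) X -> real s r Y ->
    exists f : chain_map X Y,
      is_lift f (idm A) c /\ real s (push E (first_diff X) r) (cone f);
  ea2_op : forall (A B C : K) (r : E C A) (a : Hom A B)
      (X : cpx n A C) (Y : cpx n B C),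
    real s r X -> real s (push E a r) Y ->
    exists f : chain_map X Y,
      is_lift f a (idm C) /\ real s (pull E (last_diff Y) r) (cocone f)
}.

End Exangulated.

Record ideal (k : comPzRingType) (K : linCat k) := Ideal {
  in_ideal : forall A B : K, submodClosed (Hom A B);
  ideal_compl : forall (A B C : K) (g : Hom B C) (f : Hom A B),
    f \in in_ideal A B -> g \com f \in in_ideal A C;
  ideal_compr : forall (A B C : K) (g : Hom B C) (f : Hom A B),
    g \in in_ideal B C -> g \com f \in in_ideal A C
}.

Section QuotientCategory.
Variables (k : comPzRingType) (K : linCat k) (J : ideal K).

Definition qHom (A B : K) : lmodType k := quotmod (in_ideal J A B).

Definition cls (A B : K) (f : Hom A B) : qHom A B := qclass (in_ideal J A B) f.

Definition qcomp (A B C : K) (g : qHom B C) (f : qHom A B) : qHom A C :=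
  cls (repr g \com repr f).

Lemma clsP (A B : K) (f g : Hom A B) : cls f = cls g <-> f - g \in in_ideal J A B.
Proof. exact: qclassP. Qed.

Lemma cls_ind (A B : K) (P : qHom A B -> Prop) :
  (forall f, P (cls f)) -> forall f, P f.
Proof. exact: qclass_ind. Qed.

Lemma qcompE (A B C : K) (g : Hom B C) (f : Hom A B) :
  qcomp (cls g) (cls f) = cls (g \com f).
Proof.
apply/clsP; set g' := repr _; set f' := repr _.
have Jg : g' - g \in in_ideal J B C by apply/clsP; exact: qclass_repr.
have Jf : f' - f \in in_ideal J A B by apply/clsP; exact: qclass_repr.
have -> : g' \com f' - g \com f = g' \com (f' - f) + (g' - g) \com f.
  by rewrite compDr compDl compmN compNm addrA subrK.
by apply: rpredD; [exact: ideal_compl | exact: ideal_compr].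
Qed.

Let qcompA (A B C D : K) (h : qHom C D) (g : qHom B C) (f : qHom A B) :
  qcomp h (qcomp g f) = qcomp (qcomp h g) f.
Proof.
by elim/cls_ind: h => h; elim/cls_ind: g => g; elim/cls_ind: f => f;
  rewrite !qcompE compA.
Qed.

Let qcomp1m (A B : K) (f : qHom A B) : qcomp (cls (idm B)) f = f.
Proof. by elim/cls_ind: f => f; rewrite qcompE comp1m. Qed.

Let qcompm1 (A B : K) (f : qHom A B) : qcomp f (cls (idm A)) = f.
Proof. by elim/cls_ind: f => f; rewrite qcompE compm1. Qed.

Definition quotient_category : category :=
  @Category K qHom (fun A => cls (idm A)) qcomp qcompA qcomp1m qcompm1.

End QuotientCategory.

Section Stable.
Variables (k : comPzRingType) (K : linCat k) (E : bifunctor K).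

Definition proj_trivial (A B : K) : {pred Hom A B} :=
  fun f => `[< forall (Z : K) (d : E B Z), pull E f d = 0 >].

Definition inj_trivial (A B : K) : {pred Hom A B} :=
  fun f => `[< forall (Z : K) (d : E Z A), push E f d = 0 >].

Lemma proj_trivialP A B (f : Hom A B) :
  f \in @proj_trivial A B <-> forall (Z : K) (d : E B Z), pull E f d = 0.
Proof. by split=> [/asboolP|?]; last exact/asboolP. Qed.

Lemma inj_trivialP A B (f : Hom A B) :
  f \in @inj_trivial A B <-> forall (Z : K) (d : E Z A), push E f d = 0.
Proof. by split=> [/asboolP|?]; last exact/asboolP. Qed.

Let proj_trivial_closed A B : submod_closed (@proj_trivial A B).
Proof.
split=> [|a f g /proj_trivialP f0 /proj_trivialP g0]; apply/proj_trivialP => Z d.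
  apply: (addrI (pull E (0 : Hom A B) d)); rewrite addr0.
  by have := pull_lin 1 (0 : Hom A B) 0 d; rewrite !scale1r addr0 => <-.
by rewrite pull_lin f0 g0 scaler0 addr0.
Qed.

HB.instance Definition _ A B := GRing.isSubmodClosed.Build k (Hom A B)
  (@proj_trivial A B) (@proj_trivial_closed A B).

Let inj_trivial_closed A B : submod_closed (@inj_trivial A B).
Proof.
split=> [|a f g /inj_trivialP f0 /inj_trivialP g0]; apply/inj_trivialP => Z d.
  apply: (addrI (push E (0 : Hom A B) d)); rewrite addr0.
  by have := push_lin 1 (0 : Hom A B) 0 d; rewrite !scale1r addr0 => <-.
by rewrite push_lin f0 g0 scaler0 addr0.
Qed.

HB.instance Definition _ A B := GRing.isSubmodClosed.Build k (Hom A B)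
  (@inj_trivial A B) (@inj_trivial_closed A B).

Let proj_trivial_compl A B C (g : Hom B C) (f : Hom A B) :
  f \in @proj_trivial A B -> g \com f \in @proj_trivial A C.
Proof.
by move=> /proj_trivialP f0; apply/proj_trivialP => Z d; rewrite pull_comp f0.
Qed.

Let proj_trivial_compr A B C (g : Hom B C) (f : Hom A B) :
  g \in @proj_trivial B C -> g \com f \in @proj_trivial A C.
Proof.
move=> /proj_trivialP g0; apply/proj_trivialP => Z d.
by rewrite pull_comp g0 linear0.
Qed.

Definition ideal_P : ideal K :=
  @Ideal k K (fun A B => @proj_trivial A B) proj_trivial_compl proj_trivial_compr.

Let inj_trivial_compl A B C (g : Hom B C) (f : Hom A B) :
  f \in @inj_trivial A B -> g \com f \in @inj_trivial A C.
Proof.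
move=> /inj_trivialP f0; apply/inj_trivialP => Z d.
by rewrite push_comp f0 linear0.
Qed.

Let inj_trivial_compr A B C (g : Hom B C) (f : Hom A B) :
  g \in @inj_trivial B C -> g \com f \in @inj_trivial A C.
Proof.
by move=> /inj_trivialP g0; apply/inj_trivialP => Z d; rewrite push_comp g0.
Qed.

Definition ideal_I : ideal K :=
  @Ideal k K (fun A B => @inj_trivial A B) inj_trivial_compl inj_trivial_compr.

Definition stable : category := quotient_category ideal_P.
Definition costable : category := quotient_category ideal_I.

(* The maps E(X, f) and E(f, X) depend only on the class of f: see [push_barE]
   and [pull_stE]. *)
Definition push_bar (X A B : K) (f : qHom ideal_I A B) : {linear E X A -> E X B} :=
  push E (repr f).

Definition pull_st (X A B : K) (f : qHom ideal_P A B) : {linear E B X -> E A X} :=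
  pull E (repr f).

Lemma push_barE (X A B : K) (f : Hom A B) (d : E X A) :
  push_bar X (cls ideal_I f) d = push E f d.
Proof.
have : repr (cls ideal_I f) - f \in @inj_trivial A B.
  by apply/(clsP ideal_I); exact: qclass_repr.
move=> /inj_trivialP/(_ X d).
rewrite addrC -scaleN1r push_lin scaleN1r addrC => /eqP.
by rewrite subr_eq0 => /eqP.
Qed.

Lemma pull_stE (X A B : K) (f : Hom A B) (d : E B X) :
  pull_st X (cls ideal_P f) d = pull E f d.
Proof.
have : repr (cls ideal_P f) - f \in @proj_trivial A B.
  by apply/(clsP ideal_P); exact: qclass_repr.
move=> /proj_trivialP/(_ X d).
rewrite addrC -scaleN1r pull_lin scaleN1r addrC => /eqP.
by rewrite subr_eq0 => /eqP.
Qed.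

Lemma pull_push_q (A A' B B' : K) (f : qHom ideal_P A A') (g : qHom ideal_I B B')
    (d : E A' B) :
  pull_st B' f (push_bar A' g d) = push_bar A g (pull_st B f d).
Proof. by rewrite /pull_st /push_bar push_pull. Qed.

Lemma push_bar_comp (X A B D : K) (g : qHom ideal_I B D) (f : qHom ideal_I A B)
    (d : E X A) : push_bar X (qcomp g f) d = push_bar X g (push_bar X f d).
Proof.
elim/cls_ind: g => g; elim/cls_ind: f => f.
by rewrite qcompE !push_barE push_comp.
Qed.

Lemma pull_st_comp (X A B D : K) (g : qHom ideal_P B D) (f : qHom ideal_P A B)
    (d : E D X) : pull_st X (qcomp g f) d = pull_st X f (pull_st X g d).
Proof.
elim/cls_ind: g => g; elim/cls_ind: f => f.
by rewrite qcompE !pull_stE pull_comp.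
Qed.

Variable kc : lmodType k.

(* Naturality is tested against all morphisms of the costable category, on which
   E(X, -) acts by [push_bar]; likewise for [rep_l] with [pull_st]. *)
Record rep_r (X : K) := RepR {
  rep_r_ob : K;
  phi : forall Y : K, {linear qHom ideal_I Y rep_r_ob -> dual kc (E X Y)};
  phi_bij : forall Y, bijective (phi Y);
  phi_nat : forall (Y Y' : K) (g : qHom ideal_I Y' Y) u,
    phi Y' (qcomp u g) = dual_map (push_bar X g) (phi Y u)
}.

Record rep_l (Y : K) := RepL {
  rep_l_ob : K;
  psi : forall X : K, {linear qHom ideal_P rep_l_ob X -> dual kc (E X Y)};
  psi_bij : forall X, bijective (psi X);
  psi_nat : forall (X X' : K) (g : qHom ideal_P X X') u,
    psi X' (qcomp g u) = dual_map (pull_st Y g) (psi X u)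
}.

Definition in_Cr (X : K) : Prop := inhabited (rep_r X).
Definition in_Cl (Y : K) : Prop := inhabited (rep_l Y).

Definition stable_Cr : category := full_sub (K := stable) in_Cr.
Definition costable_Cl : category := full_sub (K := costable) in_Cl.

End Stable.

Section TauFunctors.
Variables (k : comPzRingType) (K : linCat k) (E : bifunctor K) (kc : lmodType k).

Section Tau.
Variable tau : forall X : {X : K | in_Cr E kc X}, rep_r E kc (sval X).

Notation tau_ob X := (rep_r_ob (tau X)).

Lemma tau_mor_unique (X M : {X : K | in_Cr E kc X})
    (f : qHom (ideal_P E) (sval X) (sval M)) :
  exists! t : qHom (ideal_I E) (tau_ob X) (tau_ob M),
    forall Y (u : qHom (ideal_I E) Y (tau_ob X)),
      phi (tau M) Y (qcomp t u) = dual_map (pull_st Y f) (phi (tau X) Y u).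
Proof.
set id_X : qHom (ideal_I E) (tau_ob X) (tau_ob X) := cls _ (idm _).
have [psiM phiK psiK] := phi_bij (tau M) (tau_ob X).
exists (psiM (dual_map (pull_st (tau_ob X) f) (phi (tau X) _ id_X))); split.
  move=> Y u; rewrite phi_nat psiK; apply: dualP => d /=.
  rewrite pull_push_q -[u in RHS](cat_idl (c := costable E)).
  by rewrite [cat_comp _ _]/(qcomp id_X u) phi_nat.
by move=> t ht; rewrite -ht [qcomp t _](cat_idr (c := costable E)) phiK.
Qed.

Definition tau_mor X M (f : qHom (ideal_P E) (sval X) (sval M)) :
    qHom (ideal_I E) (tau_ob X) (tau_ob M) :=
  sval (cid (tau_mor_unique f)).

Lemma tau_morE X M (f : qHom (ideal_P E) (sval X) (sval M)) Y u :
  phi (tau M) Y (qcomp (tau_mor f) u)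
  = dual_map (pull_st Y f) (phi (tau X) Y u).
Proof. by rewrite /tau_mor; case: cid => t [/= ht _]. Qed.

Lemma tau_mor_eq X M (f : qHom (ideal_P E) (sval X) (sval M)) t :
  (forall Y u, phi (tau M) Y (qcomp t u)
               = dual_map (pull_st Y f) (phi (tau X) Y u)) -> tau_mor f = t.
Proof. by rewrite /tau_mor; case: cid => t' [/= _ ht]; exact: ht. Qed.

Hypothesis tau_Cl : forall X, in_Cl E kc (tau_ob X).

Let tau_fobj (X : obj (stable_Cr E kc)) : obj (costable_Cl E kc) :=
  exist _ (tau_ob X) (tau_Cl X).

Let tau_fmor (X M : obj (stable_Cr E kc)) (f : mor X M) :
  mor (tau_fobj X) (tau_fobj M) := tau_mor f.

Let tau_fmor_id X : tau_fmor (cat_id X) = cat_id (tau_fobj X).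
Proof.
apply: tau_mor_eq => Y u; rewrite [qcomp _ _](cat_idl (c := costable E)).
by apply: dualP => d /=; rewrite pull_stE pull1.
Qed.

Let tau_fmor_comp X M N (g : mor M N) (f : mor X M) :
  tau_fmor (cat_comp g f) = cat_comp (tau_fmor g) (tau_fmor f).
Proof.
apply: tau_mor_eq => Y u.
rewrite -[qcomp _ _](cat_compA (c := costable E)).
rewrite [phi _ _ _]tau_morE [phi _ _ _]tau_morE.
by apply: dualP => d /=; rewrite pull_st_comp.
Qed.

Definition tau_functor : functor (stable_Cr E kc) (costable_Cl E kc) :=
  @Functor (stable_Cr E kc) (costable_Cl E kc)
    tau_fobj tau_fmor tau_fmor_id tau_fmor_comp.

End Tau.

Section TauMinus.
Variable taum : forall Y : {Y : K | in_Cl E kc Y}, rep_l E kc (sval Y).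

Notation taum_ob Y := (rep_l_ob (taum Y)).

Lemma taum_mor_unique (Y N : {Y : K | in_Cl E kc Y})
    (g : qHom (ideal_I E) (sval Y) (sval N)) :
  exists! t : qHom (ideal_P E) (taum_ob Y) (taum_ob N),
    forall X (u : qHom (ideal_P E) (taum_ob N) X),
      psi (taum Y) X (qcomp u t) = dual_map (push_bar X g) (psi (taum N) X u).
Proof.
set id_N : qHom (ideal_P E) (taum_ob N) (taum_ob N) := cls _ (idm _).
have [phiY psiK phiK] := psi_bij (taum Y) (taum_ob N).
exists (phiY (dual_map (push_bar (taum_ob N) g) (psi (taum N) _ id_N))); split.
  move=> X u; rewrite psi_nat phiK; apply: dualP => d /=.
  rewrite -pull_push_q -[u in RHS](cat_idr (c := stable E)).
  by rewrite [cat_comp _ _]/(qcomp u id_N) psi_nat.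
by move=> t ht; rewrite -ht [qcomp _ t](cat_idl (c := stable E)) psiK.
Qed.

Definition taum_mor Y N (g : qHom (ideal_I E) (sval Y) (sval N)) :
    qHom (ideal_P E) (taum_ob Y) (taum_ob N) :=
  sval (cid (taum_mor_unique g)).

Lemma taum_morE Y N (g : qHom (ideal_I E) (sval Y) (sval N)) X u :
  psi (taum Y) X (qcomp u (taum_mor g))
  = dual_map (push_bar X g) (psi (taum N) X u).
Proof. by rewrite /taum_mor; case: cid => t [/= ht _]. Qed.

Lemma taum_mor_eq Y N (g : qHom (ideal_I E) (sval Y) (sval N)) t :
  (forall X u, psi (taum Y) X (qcomp u t)
               = dual_map (push_bar X g) (psi (taum N) X u)) -> taum_mor g = t.
Proof. by rewrite /taum_mor; case: cid => t' [/= _ ht]; exact: ht. Qed.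

Hypothesis taum_Cr : forall Y, in_Cr E kc (taum_ob Y).

Let taum_fobj (Y : obj (costable_Cl E kc)) : obj (stable_Cr E kc) :=
  exist _ (taum_ob Y) (taum_Cr Y).

Let taum_fmor (Y N : obj (costable_Cl E kc)) (g : mor Y N) :
  mor (taum_fobj Y) (taum_fobj N) := taum_mor g.

Let taum_fmor_id Y : taum_fmor (cat_id Y) = cat_id (taum_fobj Y).
Proof.
apply: taum_mor_eq => X u; rewrite [qcomp _ _](cat_idr (c := stable E)).
by apply: dualP => d /=; rewrite push_barE push1.
Qed.

Let taum_fmor_comp Y N M (g : mor N M) (f : mor Y N) :
  taum_fmor (cat_comp g f) = cat_comp (taum_fmor g) (taum_fmor f).
Proof.
apply: taum_mor_eq => X u.
rewrite [qcomp _ _](cat_compA (c := stable E)).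
rewrite [psi _ _ _]taum_morE [psi _ _ _]taum_morE.
by apply: dualP => d /=; rewrite push_bar_comp.
Qed.

Definition taum_functor : functor (costable_Cl E kc) (stable_Cr E kc) :=
  @Functor (costable_Cl E kc) (stable_Cr E kc)
    taum_fobj taum_fmor taum_fmor_id taum_fmor_comp.

End TauMinus.

End TauFunctors.

(* Main.v *)
From HB Require Import structures.
From mathcomp Require Import all_boot all_order all_algebra.
From mathcomp Require Import boolp.
Require Import Defs.

(** The theorem is Auslander-Reiten duality: if [tau X] represents [D E(X, -)] on the
    costable category, then [X] represents [D E(-, tau X)] on the stable category,
    and dually. Once this is known, [X] and [taum (tau X)] represent the same functor,
    so they are isomorphic, and the isomorphism is natural in [X].

    Write [Y = tau X] and let [alpha] be the linear form on [E(X, Y)] that corresponds to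
    the identity of [Y]. Representability says that every form on [E(X, Z)] is
    [d |-> alpha (u_* d)] for a unique costable [u : Z -> Y]. What has to be shown is that
    [f |-> (d |-> alpha (f^* d))] is a bijection from stable morphisms [X -> Z] onto the dual
    of [E(Z, Y)] ([rep_r_pairing_bij]). Injectivity is formal. For the other side, first
    let [d] in [E(Z, Y)] be orthogonal to all [f] and let [i : Y -> V_1] be the inflation
    of a realisation of [d]. Exactness of [C(X, Z) -> E(X, Y) -> E(X, V_1)]
    ([push_exact], which comes from a mapping cone) says that [alpha] vanishes on the
    kernel of [i_*]. So it extends to [E(X, V_1)], and the extension is represented by a
    costable left inverse of [i]; this forces [d = 0] ([rep_r_pairing_nondeg]).

    It remains to deduce surjectivity from this nondegeneracy, which is a matter of
    finitely generated [k]-modules ([pairing_perfect]). It holds as soon as all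
    endomorphisms of the injective cogenerator [kc] are scalars ([endo_scalar]), the
    central case of Matlis duality. Minimality of [kc] gives that each simple module occurs
    only once in its socle ([socle_multiplicity_one]): otherwise Fitting's lemma would
    split off a direct summand whose complement is still an injective cogenerator. Climbing
    a composition series, a vector of [kc] killed by the annihilator of [x] is a multiple
    of [x] ([cyclic_bicommutant]). So endomorphisms multiply each vector by a scalar,
    hence commute, and a double centraliser argument makes the scalar uniform. *)

Set Implicit Arguments.
Unset Strict Implicit.
Unset Printing Implicit Defensive.

Import GRing.Theory.
Local Open Scope ring_scope.

(** * Submodules, subobjects and quotients *)

Section Submodules.
Variables (k : comPzRingType) (M : lmodType k).

Definition submodule (U : M -> Prop) : Prop :=
  U 0 /\ forall a x y, U x -> U y -> U (a *: x + y).

Lemma submoduleD U x y : submodule U -> U x -> U y -> U (x + y).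
Proof. by move=> [_ Ul] Ux Uy; rewrite -[x]scale1r; exact: Ul. Qed.

Lemma submoduleZ U a x : submodule U -> U x -> U (a *: x).
Proof. by move=> [U0 Ul] Ux; rewrite -[a *: x]addr0; exact: Ul. Qed.

Lemma submoduleB U x y : submodule U -> U x -> U y -> U (x - y).
Proof.
by move=> [U0 Ul] Ux Uy; rewrite -scaleN1r addrC; exact: Ul.
Qed.

(** The algebraic hierarchy builds subobjects and quotients from Boolean
    predicates, so a propositional submodule is first made Boolean. *)
Definition submodule_pred U of submodule U : {pred M} := fun x => `[< U x >].

Let submodule_pred_closed U (subU : submodule U) :
  submod_closed (submodule_pred subU).
Proof.
split=> [|a x y /asboolP Ux /asboolP Uy]; apply/asboolP; first exact: subU.1.
exact: subU.2.
Qed.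

HB.instance Definition _ U (subU : submodule U) :=
  GRing.isSubmodClosed.Build k M (submodule_pred subU)
    (submodule_pred_closed subU).

Definition subobject U (subU : submodule U) : Type :=
  {x : M | x \in submodule_pred subU}.

HB.instance Definition _ U (subU : submodule U) :=
  SubChoice.on (subobject subU).
HB.instance Definition _ U (subU : submodule U) :=
  [SubChoice_isSubLmodule of subobject subU by <:].

Lemma subobject_exists U : submodule U ->
  exists (L : lmodType k) (i : {linear L -> M}),
    injective i /\ forall x, U x <-> exists l, i l = x.
Proof.
move=> subU; exists (subobject subU), (val : {linear subobject subU -> M}).
split; first exact: val_inj.
move=> x; split=> [Ux|[l <-]]; last exact/asboolP/(valP l).
have xU : x \in submodule_pred subU by exact/asboolP.
by exists (exist _ x xU).
Qed.

Lemma quotient_exists U : submodule U ->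
  exists (Q : lmodType k) (p : {linear M -> Q}),
    (forall q, exists x, p x = q) /\ forall x, p x = 0 <-> U x.
Proof.
move=> subU; pose S : submodClosed M := submodule_pred subU.
exists (quotmod S), (qclass S); split=> [q|x].
  by exists (repr q); exact: qclass_repr.
rewrite -(linear0 (qclass S)) qclassP subr0.
by split=> [/asboolP|Ux]; last exact/asboolP.
Qed.

End Submodules.

(** * Linear maps *)

Section LinearMaps.
Variable k : comPzRingType.

Lemma linear_map_exists (M L : lmodType k) (f : M -> L) : linear f ->
  exists g : {linear M -> L}, forall x, g x = f x.
Proof.
move=> lin_f; pose fL := GRing.isLinear.Build k M L *:%R f lin_f.
by exists (HB.pack_for {linear M -> L} f fL).
Qed.

Lemma scale_map_exists (M : lmodType k) (x : M) :
  exists g : {linear k^o -> M}, forall a, g a = a *: x.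
Proof.
by apply: linear_map_exists => a b c; rewrite scalerDl scalerA.
Qed.

Lemma factor_through (M Q L : lmodType k) (p : {linear M -> Q})
    (f : {linear M -> L}) :
  (forall q, exists x, p x = q) -> (forall x, p x = 0 -> f x = 0) ->
  exists g : {linear Q -> L}, forall x, g (p x) = f x.
Proof.
move=> p_surj pf; have [r rK] := choice p_surj.
have fr x : f (r (p x)) = f x.
  by apply/eqP; rewrite -subr_eq0 -linearB; apply/eqP/pf; rewrite linearB rK subrr.
have [|g gE] := @linear_map_exists _ _ (f \o r).
  move=> a x y /=; rewrite -[x]rK -[y]rK -linearP !fr.
  by rewrite linearP.
by exists g => x; rewrite gE /= fr.
Qed.

Lemma submodule0 (M : lmodType k) : submodule (fun x : M => x = 0).
Proof. by split=> // a x y -> ->; rewrite scaler0 addr0. Qed.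

Lemma submodule_ker (M L : lmodType k) (f : {linear M -> L}) :
  submodule (fun x => f x = 0).
Proof.
split=> [|a x y fx fy]; first by rewrite linear0.
by rewrite linearP fx fy scaler0 addr0.
Qed.

Lemma submodule_im (M L : lmodType k) (f : {linear M -> L}) :
  submodule (fun y => exists x, y = f x).
Proof.
split=> [|a _ _ [x ->] [y ->]]; first by exists 0; rewrite linear0.
by exists (a *: x + y); rewrite linearP.
Qed.

Definition adjoin (M : lmodType k) (U : M -> Prop) (w : M) : M -> Prop :=
  fun x => exists a, U (x - a *: w).

Lemma submodule_adjoin (M : lmodType k) (U : M -> Prop) w :
  submodule U -> submodule (adjoin U w).
Proof.
move=> subU; split=> [|a x y [b Ub] [c Uc]].
  by exists 0; rewrite scale0r subr0; exact: subU.1.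
exists (a * b + c); rewrite scalerDl -scalerA opprD addrACA -scalerBr.
exact: subU.2.
Qed.

Lemma adjoin_sub (M : lmodType k) (U : M -> Prop) w x :
  U x -> adjoin U w x.
Proof. by exists 0; rewrite scale0r subr0. Qed.

Lemma adjoin_new (M : lmodType k) (U : M -> Prop) w :
  submodule U -> adjoin U w w.
Proof. by move=> subU; exists 1; rewrite scale1r subrr; exact: subU.1. Qed.

Lemma adjoin_min (M : lmodType k) (U V : M -> Prop) w :
  submodule V -> (forall x, U x -> V x) -> V w -> forall x, adjoin U w x -> V x.
Proof.
move=> subV UV Vw x [a /UV Vxw]; rewrite -(subrK (a *: w) x).
by apply: (submoduleD subV) => //; exact: submoduleZ.
Qed.

Definition cyclic (M : lmodType k) (w : M) : M -> Prop := fun x => exists a, x = a *: w.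

Lemma submodule_cyclic (M : lmodType k) (w : M) : submodule (cyclic w).
Proof.
split=> [|a _ _ [b ->] [c ->]]; first by exists 0; rewrite scale0r.
by exists (a * b + c); rewrite scalerDl scalerA.
Qed.

Lemma cyclic_id (M : lmodType k) (w : M) : cyclic w w.
Proof. by exists 1; rewrite scale1r. Qed.

End LinearMaps.

(** * Chain conditions *)

Section ChainConditions.
Variable k : comPzRingType.

Definition span_of (M : lmodType k) m (e : 'I_m -> M) (x : M) : Prop :=
  exists c : 'I_m -> k, x = \sum_i c i *: e i.

Lemma submodule_span (M : lmodType k) m (e : 'I_m -> M) : submodule (span_of e).
Proof.
split=> [|a _ _ [c ->] [d ->]].
  by exists (fun=> 0); rewrite big1// => i _; rewrite scale0r.
exists (fun i => a * c i + d i); rewrite scaler_sumr -big_split /=.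
by apply: eq_bigr => i _; rewrite scalerDl scalerA.
Qed.

Lemma span_of_gen (M : lmodType k) m (e : 'I_m -> M) i : span_of e (e i).
Proof.
exists (fun j => (j == i)%:R); rewrite (bigD1 i)//= eqxx scale1r big1 ?addr0//.
by move=> j /negPf ->; rewrite scale0r.
Qed.

Definition sub_le (b : bool) (M : lmodType k) (U V : M -> Prop) : Prop :=
  if b then forall x, U x -> V x else forall x, V x -> U x.

(** Noetherian for [b = true], artinian for [b = false], so that the arguments that
    hold for both orders of inclusion are made once. *)
Definition chain_cond (b : bool) (M : lmodType k) : Prop :=
  forall U : nat -> M -> Prop, (forall i, submodule (U i)) ->
    (forall i, sub_le b (U i) (U i.+1)) ->
    exists N, forall i, (N <= i)%N -> forall x, U i x <-> U N x.

Lemma sub_le_chain b (M : lmodType k) (U : nat -> M -> Prop) :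
  (forall i, sub_le b (U i) (U i.+1)) ->
  forall i j, (i <= j)%N -> sub_le b (U i) (U j).
Proof.
move=> Ule i; elim=> [|j IH]; first by rewrite leqn0 => /eqP ->; case: b {Ule}.
rewrite leq_eqVlt => /predU1P[->|/IH]; first by case: b {Ule IH}.
by have := Ule j; case: b {Ule IH} => /= h1 h2 x; [move/h2/h1 | move/h1/h2].
Qed.

(** A chain of submodules stabilises once its traces on a smaller submodule and its
    ideals of leading coefficients do (the modular law). *)
Lemma chain_span b (M : lmodType k) m (e : 'I_m -> M) (U : nat -> M -> Prop) :
  chain_cond b k^o -> (forall i, submodule (U i)) ->
  (forall i, sub_le b (U i) (U i.+1)) ->
  exists N, forall i, (N <= i)%N -> forall x, span_of e x -> U i x <-> U N x.
Proof.
move=> cck subU Ule; elim: m e => [|m IH] e.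
  exists 0%N => i _ x [c ->]; rewrite big_ord0.
  by split=> _; exact: (subU _).1.
pose e' i := e (lift ord0 i).
have [N1 HN1] := IH e'.
pose I i (a : k^o) := exists v, span_of e' v /\ U i (a *: e ord0 + v).
have [i|i|N2 HN2] := cck I.
- split=> [|a x y [v [sv Uv]] [w [sw Uw]]].
    exists 0; split; first exact: (submodule_span _).1.
    by rewrite scale0r addr0; exact: (subU _).1.
  exists (a *: v + w); split; first exact: (submodule_span _).2.
  have := (subU i).2 a _ _ Uv Uw.
  by rewrite scalerDr addrACA scalerA -scalerDl.
- by have := Ule i; case: (b) => /= h a [v [sv Uv]]; exists v; split=> //; exact: h.
pose N := maxn N1 N2; exists N => i Ni x [c xE].
have N1i : (N1 <= i)%N by apply: leq_trans Ni; exact: leq_maxl.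
have N2i : (N2 <= i)%N by apply: leq_trans Ni; exact: leq_maxr.
have IiN a : I i a <-> I N a.
  by rewrite (HN2 i N2i) -(HN2 N _)//; exact: leq_maxr.
have UiN v : span_of e' v -> U i v <-> U N v.
  by move=> sv; rewrite (HN1 i N1i _ sv) -(HN1 N _ _ sv)//; exact: leq_maxl.
rewrite big_ord_recl in xE.
pose v0 := \sum_i c (lift ord0 i) *: e' i.
have sv0 : span_of e' v0 by exists (fun i => c (lift ord0 i)).
have {}xE : x = c ord0 *: e ord0 + v0 by [].
have modular (i1 i2 : nat) : (forall a, I i1 a -> I i2 a) ->
    (forall v, span_of e' v -> U i1 v -> U i2 v) ->
    (forall y, U i2 y -> U i1 y) -> U i1 x -> U i2 x.
  move=> I12 U12 U21 Ux.
  have [v [sv Uv]] : I i2 (c ord0) by apply: I12; exists v0; rewrite -xE.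
  have -> : x = (c ord0 *: e ord0 + v) + (v0 - v).
    by rewrite xE -addrA (addrC v) subrK.
  apply: submoduleD => //; apply: U12.
    by apply: submoduleB => //; exact: submodule_span.
  have -> : v0 - v = x - (c ord0 *: e ord0 + v) by rewrite xE opprD addrACA subrr add0r.
  by apply: submoduleB => //; exact: U21.
have := sub_le_chain Ule Ni; case: (b) => /= UN.
  split; last exact: UN.
  by apply: modular => [a|v sv|]; [move/IiN | move/(UiN _ sv) |].
split; first exact: UN.
by apply: modular => [a|v sv|]; [move/IiN | move/(UiN _ sv) |].
Qed.

Lemma fin_gen_chain b (M : lmodType k) :
  chain_cond b k^o -> fin_gen M -> chain_cond b M.
Proof.
move=> cck [m [e spanM]] U subU Ule.
have [N HN] := chain_span e cck subU Ule.
by exists N => i Ni x; apply: HN => //; exact: spanM.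
Qed.

(** Maximal elements for [b = true], minimal ones for [b = false]: without one, the
    family would contain an infinite strict chain. *)
Lemma chain_extremal b (M : lmodType k) (F : (M -> Prop) -> Prop) U0 :
  chain_cond b M -> (forall U, F U -> submodule U) -> F U0 ->
  exists U, F U /\ forall V, F V -> sub_le b U V -> sub_le (~~ b) U V.
Proof.
move=> ccM Fsub FU0; apply: contrapT => noU.
have step (U : {U | F U}) : exists V : {U | F U},
    sub_le b (sval U) (sval V) /\ ~ sub_le (~~ b) (sval U) (sval V).
  apply: contrapT => noV; apply: noU; exists (sval U); split; first exact: svalP U.
  move=> V FV UV; apply: contrapT => nVU; apply: noV.
  by exists (exist _ V FV).
have [f fP] := choice step.
pose U i := sval (iter i f (exist _ U0 FU0)).
have [i|i|N HN] := ccM U; [exact/Fsub/svalP | exact: (fP _).1 |].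
apply: (fP (iter N f (exist _ U0 FU0))).2.
by have := HN N.+1 (leqnSn N); rewrite /U /=; case: (b) => /= h x; move/h.
Qed.

Lemma span_adjoin (M : lmodType k) m (e : 'I_m -> M) w :
  exists e' : 'I_m.+1 -> M, forall x, span_of e' x <-> adjoin (span_of e) w x.
Proof.
pose e' i := if unlift ord0 i is Some j then e j else w.
have e'0 : e' ord0 = w by rewrite /e' unlift_none.
have e'l j : e' (lift ord0 j) = e j by rewrite /e' liftK.
exists e' => x; split=> [[c ->]|[a [c xE]]].
  rewrite big_ord_recl e'0; exists (c ord0); exists (fun j => c (lift ord0 j)).
  by rewrite addrC addKr; apply: eq_bigr => j _; rewrite e'l.
exists (fun i => if unlift ord0 i is Some j then c j else a).
rewrite big_ord_recl unlift_none e'0 -(subrK (a *: w) x) xE addrC; congr (_ + _).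
by apply: eq_bigr => j _; rewrite liftK e'l.
Qed.

(** A maximal finitely generated submodule of the image of [i] absorbs every vector
    of this image. *)
Lemma noetherian_fin_gen (M L : lmodType k) (i : {linear L -> M}) :
  chain_cond true M -> injective i -> fin_gen L.
Proof.
move=> accM inj_i.
pose F (U : M -> Prop) := (exists m (e : 'I_m -> M), forall x, U x <-> span_of e x)
  /\ forall x, U x -> exists l, x = i l.
have Fsub U : F U -> submodule U.
  move=> [[m [e Ue]] _]; split=> [|a x y]; first by apply/Ue/(submodule_span e).1.
  by move=> /Ue sx /Ue sy; apply/Ue/(submodule_span e).2.
have F0 : F (fun x => x = 0).
  split; last by move=> x ->; exists 0; rewrite linear0.
  exists 0%N, (fun=> 0) => x; split=> [->|[c ->]]; last by rewrite big_ord0.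
  exact: (submodule_span _).1.
have [U [FU maxU]] := chain_extremal accM Fsub F0.
have [[m [e Ue]] Ui] := FU.
have iU l : U (i l).
  have [e' e'E] := span_adjoin e (i l).
  apply: (maxU (span_of e')).
  - split; first by exists m.+1, e'.
    move=> x /e'E; apply: (adjoin_min (submodule_im i)); last by exists l.
    by move=> y /Ue /Ui.
  - by move=> x /Ue sx; apply/e'E; exact: adjoin_sub.
  - by apply/e'E; apply: adjoin_new; exact: submodule_span.
have [|f fE] := @choice _ _ (fun j l => e j = i l).
  by move=> j; apply: Ui; apply/Ue; exact: span_of_gen.
exists m, f => l; have [c ilE] := (Ue _).1 (iU l).
exists c; apply: inj_i; rewrite ilE linear_sum.
by apply: eq_bigr => j _; rewrite linearZ fE.
Qed.

Lemma fin_gen_surj (M Q : lmodType k) (p : {linear M -> Q}) :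
  fin_gen M -> (forall q, exists x, p x = q) -> fin_gen Q.
Proof.
move=> [m [e spanM]] p_surj; exists m, (p \o e) => q.
have [x <-] := p_surj q; have [c ->] := spanM x; exists c.
by rewrite linear_sum; apply: eq_bigr => i _; rewrite linearZ.
Qed.

Lemma fin_gen_regular : fin_gen (k^o : lmodType k).
Proof.
exists 1%N, (fun=> 1) => x; exists (fun=> x).
by rewrite big_ord1; exact/esym/mulr1.
Qed.

Lemma fin_gen_ffun (M : lmodType k) m :
  fin_gen M -> fin_gen ({ffun 'I_m -> M} : lmodType k).
Proof.
move=> [n [e spanM]].
pose T := ('I_m * 'I_n)%type.
pose d (ij : T) : {ffun 'I_m -> M} := [ffun l => if l == ij.1 then e ij.2 else 0].
exists #|{: T}|, (fun l => d (enum_val l)) => f.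
have [c cE] := choice (fun l : 'I_m => spanM (f l)).
exists (fun l => c (enum_val l).1 (enum_val l).2).
rewrite -(big_enum_val (fun ij : T => c ij.1 ij.2 *: d ij)) /=.
rewrite -(pair_bigA _ (fun i j => c i j *: d (i, j))) /=.
apply/ffunP => l; rewrite sum_ffunE (bigD1 l)//= sum_ffunE cE.
rewrite [X in _ = _ + X]big1 ?addr0 => [|i il].
  by apply: eq_bigr => j _; rewrite !ffunE /= eqxx.
rewrite sum_ffunE big1// => j _.
by rewrite !ffunE /= eq_sym (negPf il) scaler0.
Qed.

Definition ffun_single (M : lmodType k) m (i : 'I_m) (x : M) : {ffun 'I_m -> M} :=
  [ffun j => if j == i then x else 0].

Lemma linear_ffun (M L : lmodType k) m (h : {linear {ffun 'I_m -> M} -> L}) :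
  exists g : 'I_m -> {linear M -> L}, forall f, h f = \sum_i g i (f i).
Proof.
have [|g gE] := @choice _ {linear M -> L}
    (fun i g => forall x, g x = h (ffun_single i x)).
  move=> i; apply: linear_map_exists => a x y; rewrite -linearP; congr (h _).
  apply/ffunP => j; rewrite !ffunE.
  by case: eqP => // _; rewrite scaler0 addr0.
exists g => f; rewrite (eq_bigr _ (fun i _ => gE i (f i))) -linear_sum.
congr (h _); apply/ffunP => j; rewrite sum_ffunE (bigD1 j)//= big1 ?addr0.
  by rewrite ffunE eqxx.
by move=> i ij; rewrite ffunE eq_sym (negPf ij).
Qed.

End ChainConditions.

(** * Injective cogenerators over an artinian ring *)

Lemma scaler_swap (k : comPzRingType) (M : lmodType k) (a b : k) (x : M) :
  a *: (b *: x) = b *: (a *: x).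
Proof. by rewrite !scalerA mulrC. Qed.

Section Cogenerators.
Variable k : comPzRingType.

Lemma artinian_chain : artinian k -> chain_cond false (k^o : lmodType k).
Proof.
move=> artk U subU Ule; have [i|//|N HN] := artk U.
  split; first exact: (subU i).1.
    by move=> x y; exact: (submoduleD (subU i)).
  by move=> a x Ux; exact: (submoduleZ a (subU i) Ux).
exists N => i Ni x; split; last exact: HN.
exact: (sub_le_chain Ule Ni).
Qed.

Variable Q : lmodType k.

(** Test the cogenerator on the two maps [a |-> a *: v] and [0] from [k]. *)
Lemma cogenerator_separates (N : lmodType k) (v : N) :
  cogenerator_of_kmod Q -> fin_gen N -> v <> 0 ->
  exists h : {linear N -> Q}, h v <> 0.
Proof.
move=> cogen fgN v0; apply: contrapT => noh; apply: v0.
have [g gE] := scale_map_exists v.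
have /(_ 1) : g =1 (\0 : {linear k^o -> N}).
  apply: cogen => //; first exact: fin_gen_regular.
  move=> h a /=; rewrite gE linearZ_LR linear0; apply: contrapT => hv0.
  by apply: noh; exists h => hv; apply: hv0; rewrite hv scaler0.
by rewrite gE scale1r.
Qed.

(** Injectivity is only assumed against injective maps; divide [A] by the kernel
    of [T]. *)
Lemma injective_factor (A B : lmodType k) (T : {linear A -> B})
    (f : {linear A -> Q}) :
  injective_in_kmod Q -> fin_gen A -> fin_gen B ->
  (forall x, T x = 0 -> f x = 0) ->
  exists g : {linear B -> Q}, forall x, g (T x) = f x.
Proof.
move=> injQ fgA fgB Tf.
have [R [p [p_surj pE]]] := quotient_exists (submodule_ker T).
have [|T' T'E] := @factor_through _ _ _ _ p T p_surj; first by move=> x /pE.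
have [|f' f'E] := @factor_through _ _ _ _ p f p_surj.
  by move=> x /pE; exact: Tf.
have [|r r' rr'|g gE] := injQ _ _ _ fgB T' f'.
- exact: fin_gen_surj p_surj.
- have [x xE] := p_surj r; have [y yE] := p_surj r'.
  subst r r'; apply/eqP; rewrite -subr_eq0 -linearB; apply/eqP/pE.
  by rewrite linearB -!T'E rr' subrr.
by exists g => x; rewrite -T'E gE f'E.
Qed.

Lemma extend_from_vector (M : lmodType k) (x : M) (y : Q) :
  injective_in_kmod Q -> fin_gen M -> (forall a, a *: x = 0 -> a *: y = 0) ->
  exists g : {linear M -> Q}, g x = y.
Proof.
move=> injQ fgM xy.
have [T TE] := scale_map_exists x; have [f fE] := scale_map_exists y.
have [||g gE] := @injective_factor _ _ T f injQ _ fgM.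
- exact: fin_gen_regular.
- by move=> a; rewrite TE fE; exact: xy.
by exists g; rewrite -(scale1r x) -TE gE fE scale1r.
Qed.

(** An ideal [I] is recovered from the submodule of [Q] that it kills, because maps
    to [Q] separate the points of [k / I]. So ascending chains of ideals become
    descending chains of submodules of [Q]. *)
Lemma artinian_noetherian : artinian k -> fin_gen Q -> cogenerator_of_kmod Q ->
  chain_cond true (k^o : lmodType k).
Proof.
move=> artk fgQ cogen I subI Ile.
have dccQ := fin_gen_chain (artinian_chain artk) fgQ.
pose U i (x : Q) := forall a, I i a -> a *: x = 0.
have [i|i x Ux a Ia|N HN] := dccQ U.
- split=> [a _|a x y Ux Uy b Ib]; first exact: scaler0.
  by rewrite scalerDr scalerA mulrC -scalerA Ux// Uy// scaler0 addr0.
- by apply: Ux; exact: Ile.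
exists N => i Ni a; split; last exact: (sub_le_chain Ile Ni).
move=> Ia; apply: contrapT => INa.
have [R [p [p_surj pE]]] := quotient_exists (subI N).
have fgR := fin_gen_surj (fin_gen_regular k) p_surj.
have pa : p a <> 0 by move/pE.
have [h hpa] := cogenerator_separates cogen fgR pa.
have hpE (b : k^o) : h (p b) = b *: h (p 1).
  by rewrite -!linearZ; congr (h (p _)); exact/esym/mulr1.
apply: hpa; rewrite hpE; apply: (HN i Ni _).2 => // b Ib.
by rewrite -hpE (pE b).2 // linear0.
Qed.

End Cogenerators.

Section MinimalCogenerator.
Variables (k : comPzRingType) (artk : artinian k) (Q : lmodType k).
Hypothesis Q_min : minimal_inj_cogenerator Q.

Let fgQ : fin_gen Q. Proof. by case: Q_min => -[]. Qed.
Let injQ : injective_in_kmod Q. Proof. by case: Q_min => -[]. Qed.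
Let cogenQ : cogenerator_of_kmod Q. Proof. by case: Q_min => -[]. Qed.
Let dccQ : chain_cond false Q.
Proof. exact/fin_gen_chain/fgQ/artinian_chain. Qed.
Let acck : chain_cond true (k^o : lmodType k).
Proof. exact: artinian_noetherian cogenQ. Qed.
Let accQ : chain_cond true Q. Proof. exact/fin_gen_chain/fgQ/acck. Qed.

(** The generators of the simple submodules of [Q], that is, the nonzero vectors
    whose annihilator is a maximal ideal. *)
Definition simple_vector (z : Q) : Prop :=
  z <> 0 /\ forall b, b *: z <> 0 -> exists c, c *: (b *: z) = z.

Lemma simple_multiple (w : Q) : w <> 0 -> exists b, simple_vector (b *: w).
Proof.
move=> w0; pose F U := exists b, b *: w <> 0 /\ forall x, U x <-> cyclic (b *: w) x.
have [U [b [_ UE]]||U [[b [bw0 UE]] minU]] :=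
    chain_extremal (F := F) (U0 := cyclic w) dccQ.
- split=> [|a x y /UE Ux /UE Uy]; apply/UE; first exact: (submodule_cyclic _).1.
  exact: (submodule_cyclic _).2.
- by exists 1; rewrite scale1r.
exists b; split=> // c cbw0.
have Ubc : forall x, U x -> cyclic (c *: (b *: w)) x.
  apply: minU; first by exists (c * b); rewrite -scalerA.
  by move=> _ [a ->]; apply/UE; exists (a * c); rewrite scalerA.
have [|a aE] := Ubc (b *: w); first by apply/UE; exact: cyclic_id.
by exists a.
Qed.

(** * Fitting's lemma and the socle of the minimal injective cogenerator *)

Lemma iter_linear (s : {linear Q -> Q}) n :
  exists t : {linear Q -> Q}, forall x, t x = iter n s x.
Proof.
apply: linear_map_exists => a x y.
by elim: n => //= n ->; rewrite linearP.
Qed.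

Lemma submodule_iter_im (s : {linear Q -> Q}) n :
  submodule (fun x => exists y, x = iter n s y).
Proof.
have [t tE] := iter_linear s n; split=> [|a _ _ [x ->] [y ->]].
  by exists 0; rewrite -tE linear0.
by exists (a *: x + y); rewrite -!tE linearP.
Qed.

(** [t] is a power of [s] large enough for its kernel and its image to be stable,
    so that [Q] is the direct sum of the two. The exponent is positive so that [t]
    kills the kernel of [s]. *)
Lemma fitting (s : {linear Q -> Q}) :
  exists (t : {linear Q -> Q}) (n : nat),
    [/\ forall x, t x = iter n.+1 s x, forall x, t (t x) = 0 -> t x = 0
      & forall x, exists y, t x = t (t y)].
Proof.
have [i|i x /= xE|N1 HN1] := accQ (U := fun n x => iter n s x = 0).
- by have [t tE] := iter_linear s i; split=> [|a x y]; rewrite -!tE;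
    [rewrite linear0 | rewrite linearP => -> ->; rewrite scaler0 addr0].
- by rewrite xE linear0.
have [i|i _ [y ->]|N2 HN2] := dccQ (U := fun n x => exists y, x = iter n s y).
- exact: submodule_iter_im.
- by exists (s y); rewrite -iterSr.
pose n := (maxn N1 N2); have [t tE] := iter_linear s n.+1.
have n1 : (N1 <= n)%N by exact: leq_maxl.
have n2 : (N2 <= n)%N by exact: leq_maxr.
have stable m : (n <= m)%N -> (forall x, iter m s x = 0 <-> iter N1 s x = 0) /\
    forall x, (exists y, x = iter m s y) <-> exists y, x = iter N2 s y.
  by move=> nm; split; [apply: HN1 | apply: HN2]; apply: leq_trans nm.
have [ker1 im1] := stable n.+1 (leqnSn n).
have [ker2 im2] := stable (n.+1 + n.+1)%N (leq_trans (leqnSn n) (leq_addr _ _)).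
exists t, n; split=> // x; first by rewrite !tE -iterD => /ker2/ker1.
have [|y yE] := (im2 (iter n.+1 s x)).2; first by apply/im1; exists x.
by exists y; rewrite !tE yE iterD.
Qed.

(** For [t] as in Fitting's lemma, [Q / ker t] is a direct summand of [Q], hence
    injective. The third hypothesis makes it a cogenerator, so minimality embeds [Q]
    in it, that is, in the image of [t]. An injective endomorphism of an artinian
    module is onto; hence [t] is onto, and as its kernel is stable it is injective. *)
Lemma minimal_fitting_injective (t : {linear Q -> Q}) :
  (forall x, t (t x) = 0 -> t x = 0) -> (forall x, exists y, t x = t (t y)) ->
  (forall w, w <> 0 -> exists g : {linear Q -> Q}, t (g w) <> 0) ->
  forall x, t x = 0 -> x = 0.
Proof.
move=> ker_t im_t sep_t.
have [R [p [p_surj pE]]] := quotient_exists (submodule_ker t).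
have p_eq x y : p x = p y <-> t x = t y.
  by split=> xy; apply/eqP; rewrite -subr_eq0 -linearB;
    apply/eqP; [apply/pE | apply/(pE (x - y))]; rewrite linearB xy subrr.
have [|t' t'E] := @factor_through _ _ _ _ p t p_surj; first by move=> x /pE.
(* By stability of the image, each [t x] is [t (t y)]; [x |-> p y] is a
   retraction of the embedding [t'] of [R] in [Q]. *)
have [r rE] : exists r : {linear Q -> R}, forall q, r (t' q) = q.
  have [y yE] := choice im_t.
  have [|r rE] := @linear_map_exists _ _ _ (p \o y).
    move=> a u v; rewrite /= -linearP; apply/p_eq/eqP; rewrite -subr_eq0 -linearB.
    apply/eqP/ker_t; rewrite !linearB [t (a *: _ + _)]linearP.
    by rewrite [t (a *: _ + _)]linearP -!yE linearP subrr.
  exists r => q; have [x <-] := p_surj q.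
  rewrite t'E rE /=; apply/p_eq/eqP; rewrite -subr_eq0 -linearB.
  by apply/eqP/ker_t; rewrite !linearB -yE subrr.
have fgR := fin_gen_surj fgQ p_surj.
have R_cogen : inj_cogenerator R.
  split=> // [M N fgM fgN i f inj_i|M N fgM fgN f g eq_fg x].
    have [g gE] := injQ fgM fgN (t' \o f : {linear M -> Q}) inj_i.
    by exists (r \o g : {linear N -> R}) => x /=; rewrite gE /= rE.
  apply: contrapT => fgx.
  have v0 : f x - g x <> 0 by move/eqP; rewrite subr_eq0 => /eqP.
  have [h hv] := cogenerator_separates cogenQ fgN v0.
  have [u tu] := sep_t _ hv; apply: tu.
  have := eq_fg (p \o u \o h : {linear N -> R}) x; rewrite /= => /p_eq pfg.
  by rewrite !linearB pfg subrr.
have [i inj_i] := Q_min.2 R R_cogen.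
pose j : {linear Q -> Q} := t' \o i.
have inj_j : injective j by move=> x y /= /(congr1 r); rewrite !rE => /inj_i.
have t_surj x : exists y, x = t y.
  have [u|u _ [y ->]|N HN] := dccQ (U := fun n x => exists y, x = iter n j y).
  - exact: submodule_iter_im.
  - by exists (j y); rewrite -iterSr.
  have [|y] := (HN N.+1 (leqnSn N) (iter N j x)).2; first by exists x.
  rewrite iterSr => xE; have {}xE : x = j y.
    by elim: (N) xE => //= m IH /inj_j.
  have [z zE] := p_surj (i y); exists z; rewrite xE /= -zE.
  exact: t'E.
move=> x tx0; have [y xE] := t_surj x; rewrite xE in tx0 *.
exact: ker_t.
Qed.

(** Two independent simple vectors with the same annihilator would make [Q] too
    large. Some endomorphism [s] would kill [z] and fix [z'] together with [O], the
    vectors killed by some scalar that does not kill [z]. Every simple module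
    occurs in the span [V] of [z'] and [O], so the quotient of [Q] by the stable kernel
    of [s] is still a cogenerator, against the previous lemma. *)
Lemma socle_multiplicity_one (z z' : Q) :
  simple_vector z -> (forall a, a *: z = 0 -> a *: z' = 0) -> cyclic z z'.
Proof.
move=> [z0 z_simple] zz'; apply: contrapT => z'z.
pose O (x : Q) := exists a, a *: z <> 0 /\ a *: x = 0.
have subO : submodule O.
  split=> [|c x y [a [az ax]] [b [bz bY]]]; first by exists 1; rewrite scale1r scaler0.
  exists (a * b); split; last first.
    rewrite scalerDr -!scalerA bY scaler0 addr0.
    by rewrite (scaler_swap b c) (scaler_swap a c) (scaler_swap a b) ax !scaler0.
  have [c' c'E] := z_simple b bz.
  by move=> abz; apply: az; rewrite -c'E scaler_swap (scalerA a b) abz scaler0.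
pose V := adjoin O z'.
have subV : submodule V by exact: submodule_adjoin.
have [L [i [inj_i Vi]]] := subobject_exists subV.
have [P [p [p_surj pE]]] := quotient_exists (submodule_cyclic z).
(* [V] meets the line of [z] trivially, so it embeds in the quotient by that line. *)
have V_cyclic x : V x -> cyclic z x -> x = 0.
  move=> [b [d [dz dx]]] [a xE]; rewrite {}xE in dx *.
  have [c cE] := z_simple d dz.
  have cz' : (c * d) *: z' = z'.
    apply/eqP; rewrite -subr_eq0 -[X in _ - X]scale1r -scalerBl; apply/eqP/zz'.
    by rewrite scalerBl scale1r -scalerA cE subrr.
  have azE : a *: z = b *: z'.
    have : (c * d) *: (a *: z - b *: z') = 0 by rewrite -scalerA dx scaler0.
    rewrite scalerBr !(scaler_swap (c * d)) cz' -scalerA cE.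
    by move/eqP; rewrite subr_eq0 => /eqP.
  apply: contrapT => az0; apply: z'z.
  have bz : b *: z <> 0 by move/zz'; rewrite -azE.
  have [e eE] := z_simple b bz.
  exists (e * a); rewrite -scalerA azE; apply/eqP.
  rewrite -subr_eq0 -[X in X - _]scale1r scalerA -scalerBl; apply/eqP/zz'.
  by rewrite scalerBl scale1r -scalerA eE subrr.
have [|||s' s'E] := @injective_factor _ _ _ _ (p \o i : {linear L -> P}) i injQ.
- exact: noetherian_fin_gen inj_i.
- exact: fin_gen_surj p_surj.
- by move=> l /pE; apply: V_cyclic; apply/Vi; exists l.
pose s : {linear Q -> Q} := s' \o p.
have sz : s z = 0 by rewrite /= (pE z).2 ?linear0//; exact: cyclic_id.
have sV x : V x -> s x = x by move=> /Vi[l <-]; exact: s'E.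
have [t [n [tE ker_t im_t]]] := fitting s.
have tV x : V x -> t x = x.
  by move=> Vx; rewrite tE; elim: (n.+1) => //= m ->; exact: sV.
have tz : t z = 0.
  rewrite tE iterSr sz; elim: (n) => //= m ->.
  by rewrite !linear0.
apply: z0; apply: (minimal_fitting_injective ker_t im_t) tz => w w0.
have [b [bw0 bw_simple]] := simple_multiple w0.
(* If the simple vector [b w] is not in [O], its annihilator is contained in that
   of [z], so [b w] can be sent to [z']. *)
have [[a [abw az]]|bwz] := pselect (exists a, a *: (b *: w) = 0 /\ a *: z <> 0).
  exists idfun => /= tw; apply: bw0; rewrite -[b *: w]tV ?linearZ /= ?tw ?scaler0//.
  by apply: adjoin_sub; exists a.
have [|g gE] := extend_from_vector (x := b *: w) (y := z') injQ fgQ.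
  by move=> a abw; apply: zz'; apply: contrapT => az; apply: bwz; exists a.
exists g => tgw; apply: z'z; exists 0; rewrite scale0r.
rewrite -[z']tV; last exact: adjoin_new.
by rewrite -gE linearZ linearZ_LR tgw scaler0.
Qed.

(** * Endomorphisms of the minimal injective cogenerator *)

Definition bicommutant (U : Q -> Prop) (y : Q) : Prop :=
  forall a, (forall u, U u -> a *: u = 0) -> a *: y = 0.

(** Let [w] be simple modulo [U], and let [b] kill [U] but not [w]. Then [b w] is a
    simple vector, and for [y] in the bicommutant of the larger module [b y] is a
    multiple [c b w] of it, by multiplicity one. Every scalar that kills [U] acts on [w]
    and [y] as a multiple of [b], so it kills [y - c w]; thus [y - c w] lies in the
    bicommutant of [U], which is [U]. *)
Lemma bicommutant_adjoin (U : Q -> Prop) (w : Q) :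
  submodule U -> (forall y, bicommutant U y -> U y) -> ~ U w ->
  (forall b, ~ U (b *: w) -> exists c, U (w - c *: (b *: w))) ->
  forall y, bicommutant (adjoin U w) y -> adjoin U w y.
Proof.
move=> subU closedU Uw w_simple y yU.
have kills a : (forall u, U u -> a *: u = 0) -> a *: w = 0 ->
    forall u, adjoin U w u -> a *: u = 0.
  by move=> aU aw u [c /aU]; rewrite scalerBr scalerA mulrC -scalerA aw scaler0 subr0.
have [b [bU bw0]] : exists b, (forall u, U u -> b *: u = 0) /\ b *: w <> 0.
  apply: contrapT => nob; apply/Uw/closedU => b bU.
  by apply: contrapT => bw; apply: nob; exists b.
have w_mod d : b *: (d *: w) <> 0 -> exists c, U (w - c *: (d *: w)).
  by move=> bdw; apply: w_simple => /bU.
have bw_simple : simple_vector (b *: w).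
  split=> // d; rewrite scaler_swap => /w_mod[c /bU] /eqP.
  by rewrite scalerBr subr_eq0 => /eqP bwE; exists c; rewrite !(scaler_swap _ b).
have [|c byE] := socle_multiplicity_one (z' := b *: y) bw_simple.
  move=> a; rewrite !scalerA => abw; apply: yU; apply: kills => // u Uu.
  by rewrite -scalerA bU ?scaler0.
exists c; apply: closedU => a aU.
have [|e awE] := socle_multiplicity_one (z' := a *: w) bw_simple.
  move=> d dbw; rewrite scaler_swap; apply/aU; apply: contrapT => dw.
  have [f /bU /eqP] := w_simple d dw.
  rewrite scalerBr subr_eq0 => /eqP bwE; apply: bw0.
  by rewrite bwE scaler_swap (scaler_swap b) dbw scaler0.
have : (a - e * b) *: y = 0.
  apply: yU; apply: kills => [u Uu|].
    by rewrite scalerBl aU// -scalerA bU// scaler0 subrr.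
  by rewrite scalerBl awE scalerA subrr.
move/eqP; rewrite scalerBl subr_eq0 => /eqP ayE.
by rewrite scalerBr ayE -scalerA byE scaler_swap -awE scaler_swap subrr.
Qed.

(** A cyclic submodule is its own bicommutant: climb a composition series, as a
    maximal submodule of it with this property must be the whole of it. *)
Lemma cyclic_bicommutant (x y : Q) :
  (forall a, a *: x = 0 -> a *: y = 0) -> cyclic x y.
Proof.
move=> xy.
pose F (U : Q -> Prop) := [/\ submodule U, forall u, U u -> cyclic x u
  & forall u, bicommutant U u -> U u].
have [U||U [[subU Ux closedU] maxU]] :=
    chain_extremal (F := F) (U0 := fun u => u = 0) accQ.
- by case.
- split; first exact: submodule0.
    by move=> u ->; exact: (submodule_cyclic x).1.
  by move=> u /(_ 1); rewrite scale1r; apply=> _ ->; rewrite scaler0.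
have Ux' : U x.
  apply: contrapT => nUx.
  pose G (W : Q -> Prop) := exists w, [/\ cyclic x w, ~ U w
    & forall u, W u <-> adjoin U w u].
  have [W||W [[w [xw Uw WE]] minW]] :=
      chain_extremal (F := G) (U0 := adjoin U x) dccQ.
  - move=> [w [_ _ WE]]; have subUw := submodule_adjoin w subU.
    split=> [|a u v /WE Wu /WE Wv]; apply/WE; first exact: subUw.1.
    exact: subUw.2.
  - by exists x; split=> //; exact: cyclic_id.
  apply: (Uw); apply: (maxU (adjoin U w)).
  - split; first exact: submodule_adjoin.
      by apply: adjoin_min => //; exact: submodule_cyclic.
    apply: (bicommutant_adjoin subU closedU Uw) => b Ubw.
    have Wbw : forall u, W u -> adjoin U (b *: w) u.
      apply: minW.
        exists (b *: w); split=> //; apply: submoduleZ => //.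
        exact: submodule_cyclic.
      move=> u ubw; apply/WE; apply: adjoin_min ubw.
      + exact: submodule_adjoin.
      + by move=> v; exact: adjoin_sub.
      + by apply: submoduleZ; [exact: submodule_adjoin | exact: adjoin_new].
    by have [|c] := Wbw w; [apply/WE; exact: adjoin_new | exists c].
  - by move=> u; exact: adjoin_sub.
  - exact: adjoin_new.
by apply: Ux; apply: closedU => a aU; exact/xy/aU.
Qed.

(** By the previous lemma an endomorphism multiplies each vector by a scalar, which may
    still depend on the vector. *)
Lemma endo_comm (s t : {linear Q -> Q}) x : s (t x) = t (s x).
Proof.
have endo_scalar (u : {linear Q -> Q}) y : cyclic y (u y).
  by apply: cyclic_bicommutant => a ay; rewrite -linearZ ay linear0.
have [a sE] := endo_scalar s x; have [b tE] := endo_scalar t x.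
by rewrite sE tE !linearZ sE tE /= !scalerA mulrC.
Qed.

(** Double centraliser argument: if [s] is not a scalar on the generators [e] of [Q],
    some functional on [Q^m] kills the tuple [e] and not the tuple [s e]. But its
    components are endomorphisms of [Q], so they commute with [s]. *)
Lemma endo_scalar (s : {linear Q -> Q}) : exists a, forall x, s x = a *: x.
Proof.
have [m [e spanQ]] := fgQ.
pose X : {ffun 'I_m -> Q} := [ffun i => e i].
pose sX : {ffun 'I_m -> Q} := [ffun i => s (e i)].
have [P [p [p_surj pE]]] := quotient_exists (submodule_cyclic X).
have [a sXE] : cyclic X sX.
  apply: contrapT => /pE psX.
  have fgP : fin_gen P by apply: fin_gen_surj p_surj; exact: fin_gen_ffun.
  have [h hpsX] := cogenerator_separates cogenQ fgP psX.
  have [g gE] := linear_ffun (h \o p : {linear {ffun 'I_m -> Q} -> Q}).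
  apply: hpsX; transitivity (s (h (p X))).
    rewrite [h (p X)]gE [LHS]gE linear_sum; apply: eq_bigr => i _.
    by rewrite !ffunE endo_comm.
  by rewrite (pE X).2 ?linear0//; exact: cyclic_id.
exists a => x; have [c ->] := spanQ x.
rewrite linear_sum scaler_sumr; apply: eq_bigr => i _.
have := congr1 (fun f : {ffun 'I_m -> Q} => f i) sXE; rewrite !ffunE linearZ /= => ->.
by rewrite !scalerA mulrC.
Qed.

(** This form of Matlis duality is where minimality of [Q] enters. A functional on
    [N] is given by its values on the generators [e], a point of [Q^m]. If the point of
    [f] is not among those coming from [M], a functional on [Q^m] separates it from
    them. The components of that functional are scalars [a_i], so it is evaluation at
    [\sum_i a_i e_i]; this vector is orthogonal to [M], hence zero, and cannot
    separate anything. *)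
Lemma pairing_perfect (M N : lmodType k) (B : {linear M -> dual Q N}) :
  fin_gen N -> (forall v, (forall u, B u v = 0) -> v = 0) ->
  forall f : dual Q N, exists u, B u = f.
Proof.
move=> [m [e spanN]] B_nondeg f.
pose val_e (g : dual Q N) : {ffun 'I_m -> Q} := [ffun i => g (e i)].
have val_e_inj g g' : val_e g = val_e g' -> g = g'.
  move=> /ffunP gg'; apply: dualP => x; have [c ->] := spanN x.
  rewrite !linear_sum; apply: eq_bigr => i _.
  by have := gg' i; rewrite !ffunE !linearZ /= => ->.
have [|b bE] := @linear_map_exists k M _ (val_e \o B).
  by move=> a u v; apply/ffunP => i; rewrite !ffunE linearP.
have [P [p [p_surj pE]]] := quotient_exists (submodule_im b).
apply: contrapT => nof.
have pf : p (val_e f) <> 0.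
  by move=> /pE[u fE]; apply: nof; exists u; apply: val_e_inj; rewrite fE bE.
have fgP : fin_gen P by apply: fin_gen_surj p_surj; exact: fin_gen_ffun.
have [h hpf] := cogenerator_separates cogenQ fgP pf.
have [g gE] := linear_ffun (h \o p : {linear {ffun 'I_m -> Q} -> Q}).
have [a aE] := choice (fun i => endo_scalar (g i)).
have hE (f' : dual Q N) : h (p (val_e f')) = f' (\sum_i a i *: e i).
  rewrite [LHS]gE linear_sum; apply: eq_bigr => i _.
  by rewrite aE ffunE linearZ.
apply: hpf; rewrite hE (B_nondeg (\sum_i a i *: e i)) ?linear0// => u; rewrite -hE.
by rewrite (pE _).2 ?linear0//; exists u; rewrite bE.
Qed.

End MinimalCogenerator.

(** * Long exact sequences of extensions *)

Section LongExactSequences.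
Variables (k : comPzRingType) (C : linCat k) (E : bifunctor C) (n : nat).
Variable s : exact_realization E n.
Hypothesis exaC : n_exangulated s.

Lemma pullD (A X X' : C) (f g : Hom X' X) (d : E X A) :
  pull E (f + g) d = pull E f d + pull E g d.
Proof. by have := pull_lin 1 f g d; rewrite !scale1r. Qed.

Lemma pushD (A A' X : C) (f g : Hom A A') (d : E X A) :
  push E (f + g) d = push E f d + push E g d.
Proof. by have := push_lin 1 f g d; rewrite !scale1r. Qed.

Lemma pull0 (A X X' : C) (d : E X A) : pull E (0 : Hom X' X) d = 0.
Proof. by apply: (addrI (pull E (0 : Hom X' X) d)); rewrite -pullD !addr0. Qed.

Lemma push0 (A A' X : C) (d : E X A) : push E (0 : Hom A A') d = 0.
Proof. by apply: (addrI (push E (0 : Hom A A') d)); rewrite -pushD !addr0. Qed.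

Lemma realized (A X : C) (d : E X A) : exists V, real s d V.
Proof.
have [V VE] := real_class s d; exists V; apply/VE.
pose id_V : chain_map V V :=
  @ChainMap _ _ _ _ _ _ _ V V (fun i => idm (V i))
    (fun i _ => etrans (comp1m _) (esym (compm1 _))).
have id_lift : is_lift (X := V) (Y := V) id_V (idm A) (idm X).
  by split; rewrite compm1 comp1m.
have id_homotopic : homotopic (X := V) (Y := V)
    (fun i => id_V i \com id_V i) (fun i => idm (V i)).
  exists (fun=> 0); split=> [|i _|] /=; rewrite ?compm0 ?comp0m compm1 subrr//.
  by rewrite addr0.
by exists id_V, id_V.
Qed.

Lemma last_diff_split (A X : C) (V : cpx n A X) :
  real s (0 : E X A) V -> exists h, idm X = last_diff V \com h.
Proof.
by move=> /real_exangle[_ pullV _ _]; apply/pullV; rewrite linear0.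
Qed.

Lemma first_diff_split (A X : C) (V : cpx n A X) :
  real s (0 : E X A) V -> exists h, idm A = h \com first_diff V.
Proof.
by move=> /real_exangle[_ _ _ pushV]; apply/pushV; rewrite linear0.
Qed.

Lemma pull_last_diff (A X : C) (d : E X A) (V : cpx n A X) :
  real s d V -> pull E (last_diff V) d = 0.
Proof.
by move=> /real_exangle[_ pullV _ _]; apply/pullV; exists (idm _); rewrite compm1.
Qed.

Lemma push_first_diff (A X : C) (d : E X A) (V : cpx n A X) :
  real s d V -> push E (first_diff V) d = 0.
Proof.
by move=> /real_exangle[_ _ _ pushV]; apply/pushV; exists (idm _); rewrite comp1m.
Qed.

Lemma last_diff_cone (A X D : C) (c : Hom X D) (V : cpx n A X) (W : cpx n A D)
    (f : chain_map V W) : (0 < n)%N -> is_lift (X := V) (Y := W) f (idm A) c ->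
  exists p q, last_diff (cone f) = c \com p + last_diff W \com q.
Proof.
case: n V W f => // m V W f _ [_ lift_c].
(* The last term of the cone depends on the test [n < n]; its value can be used
   only once the test is a variable, as the casts depend on it. *)
have inY j (b : bool) (e : cone_sum V W j b = D) (e' : W j.+1 = D) : b = false ->
    eq_hom e \com cone_inY V W j b = eq_hom e'.
  by case: b e => //= e _; rewrite compm1; congr eq_hom; exact: Prop_irrelevance.
have inX j (b : bool) (e : cone_sum V W j b = D) : b = false ->
    eq_hom e \com cone_inX V W j b = 0.
  by case: b e => //= e _; rewrite compm0.
exists (eq_hom (term_last V) \com cone_prX V W m (m < m.+1)%N).
exists (cone_prY V W m (m < m.+1)%N).
rewrite /last_diff /= !compDr compmN !compA inX ?ltnn// !comp0m oppr0 add0r.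
by rewrite !(inY _ _ _ (term_last W)) ?ltnn// lift_c.
Qed.

Lemma first_diff_cocone (A A' X : C) (a : Hom A A') (V : cpx n A X) (W : cpx n A' X)
    (f : chain_map V W) : is_lift (X := V) (Y := W) f a (idm X) ->
  exists p q, first_diff (cocone f) = p \com a + q \com first_diff V.
Proof.
move=> [lift_a _].
exists (cocone_inY V W 0 (0 < n)%N \com eq_hom (esym (term_first W))).
exists (cocone_inX V W 0 (0 < n)%N).
rewrite /first_diff /= compDl !compA; congr (_ + _).
have <- : eq_hom (esym (term_first W)) \com (a \com eq_hom (term_first V)) = f 0%N.
  by rewrite -lift_a compA eq_homK comp1m.
by rewrite -!compA eq_homVK compm1.
Qed.

(** The sum of [d] and [x] in [E (Y + X, A)] restricts to [d] along [inl_], and the mapping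
    cone of this restriction realises a push-forward of the sum that vanishes. So its last
    differential splits, and one component of a section is the required factorisation. *)
Lemma push_exact (A X Y : C) (d : E Y A) (V : cpx n A Y) (x : E X A) : (0 < n)%N ->
  real s d V -> push E (first_diff V) x = 0 -> exists f : Hom X Y, x = pull E f d.
Proof.
move=> n0 dV Vx; pose r := pull E (prl_ Y X) d + pull E (prr_ Y X) x.
have rl : pull E (inl_ Y X) r = d.
  by rewrite linearD -!pull_comp prl_inl prr_inl pull1 pull0 addr0.
have rr : pull E (inr_ Y X) r = x.
  by rewrite linearD -!pull_comp prl_inr prr_inr pull1 pull0 add0r.
have [W rW] := realized r.
have [|f [lift_f]] := ea2 exaC (c := inl_ Y X) (X := V) _ rW; first by rewrite rl.
have -> : push E (first_diff V) r = 0.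
  by rewrite linearD !push_pull (push_first_diff dV) Vx !linear0 addr0.
move=> /last_diff_split[h hE].
have [p [q]] := last_diff_cone n0 lift_f.
move: (last_diff W) (pull_last_diff rW) => w w_r pqE.
exists (p \com h \com inr_ Y X).
rewrite -[LHS]rr -{1}[inr_ Y X]comp1m hE pqE !compDl pullD -!compA.
by rewrite !pull_comp rl w_r !linear0 addr0.
Qed.

(** Dual to [push_exact], with [d] and [x] placed in [E (X, A + B)]. *)
Lemma pull_exact (A B X : C) (d : E X A) (V : cpx n A X) (x : E X B) :
  real s d V -> pull E (last_diff V) x = 0 -> exists f : Hom A B, x = push E f d.
Proof.
move=> dV Vx; pose r := push E (inl_ A B) d + push E (inr_ A B) x.
have rl : push E (prl_ A B) r = d.
  by rewrite linearD -!push_comp prl_inl prl_inr push1 push0 addr0.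
have rr : push E (prr_ A B) r = x.
  by rewrite linearD -!push_comp prr_inl prr_inr push1 push0 add0r.
have [W rW] := realized r.
have [|f [lift_f]] := ea2_op exaC (a := prl_ A B) (Y := V) rW; first by rewrite rl.
have -> : pull E (last_diff V) r = 0.
  by rewrite linearD -!push_pull (pull_last_diff dV) Vx !linear0 addr0.
move=> /first_diff_split[h hE].
have [p [q]] := first_diff_cocone lift_f.
move: (first_diff W) (push_first_diff rW) => w w_r pqE.
exists (prr_ A B \com h \com p).
rewrite -[LHS]rr -{1}[prr_ A B]compm1 hE pqE !compDr pushD !compA.
by rewrite !push_comp rl w_r !linear0 addr0.
Qed.

End LongExactSequences.

(** * Auslander-Reiten duality *)

Lemma surj_bijective (A B : Type) (f : A -> B) :
  injective f -> (forall y, exists x, f x = y) -> bijective f.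
Proof.
move=> inj_f /choice[g gK]; exists g => // x.
by apply: inj_f; rewrite gK.
Qed.

Lemma iso_full_sub (K : category) (P : obj K -> Prop) (A B : obj (full_sub P))
    (f : @mor K (sval A) (sval B)) :
  @cat_iso K _ _ f -> @cat_iso (full_sub P) A B f.
Proof. by []. Qed.

Lemma cat_iso_sym (K : category) (A B : obj K) (f : mor A B) : cat_iso f ->
  exists g : mor B A, [/\ cat_iso g, cat_comp g f = cat_id A & cat_comp f g = cat_id B].
Proof. by move=> [g [gf fg]]; exists g; split=> //; exists f. Qed.

Lemma nat_isomorphic_sym (K L : category) (F G : functor K L) :
  nat_isomorphic F G -> nat_isomorphic G F.
Proof.
move=> [eta [eta_iso eta_nat]].
pose eta' A := sval (cid (cat_iso_sym (eta_iso A))).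
have eta'P A : [/\ cat_iso (eta' A), cat_comp (eta' A) (eta A) = cat_id (F A)
    & cat_comp (eta A) (eta' A) = cat_id (G A)] by rewrite /eta'; case: cid.
exists eta'; split=> [A|A B f]; first by case: (eta'P A).
have [_ _ eA] := eta'P A; have [_ eB _] := eta'P B.
rewrite -[LHS]cat_idr -eA -cat_compA (cat_compA (fmor G f)) -eta_nat.
by rewrite !cat_compA eB cat_idl.
Qed.

Section QuotientComposition.
Variables (k : comPzRingType) (C : linCat k) (J : ideal C).

Lemma qcompA (A B D F : C) (h : qHom J D F) (g : qHom J B D) (f : qHom J A B) :
  qcomp h (qcomp g f) = qcomp (qcomp h g) f.
Proof. exact: (cat_compA (c := quotient_category J)). Qed.

Lemma qcomp1m (A B : C) (f : qHom J A B) : qcomp (cls J (idm B)) f = f.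
Proof. exact: (cat_idl (c := quotient_category J)). Qed.

Lemma qcompm1 (A B : C) (f : qHom J A B) : qcomp f (cls J (idm A)) = f.
Proof. exact: (cat_idr (c := quotient_category J)). Qed.

End QuotientComposition.

Section AuslanderReitenDuality.
Variables (k : comPzRingType) (artk : artinian k) (kc : lmodType k).
Hypothesis kc_min : minimal_inj_cogenerator kc.
Variables (n : nat) (n_gt0 : (0 < n)%N) (C : linCat k) (E : bifunctor C).
Variable s : exact_realization E n.
Hypotheses (exaC : n_exangulated s) (finE : Ext_finite E).

Let injQ : injective_in_kmod kc. Proof. by case: kc_min => -[]. Qed.
Let cogenQ : cogenerator_of_kmod kc. Proof. by case: kc_min => -[]. Qed.

Lemma pull_st_lin (Z X Y : C) (d : E Y Z) a (u v : qHom (ideal_P E) X Y) :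
  pull_st Z (a *: u + v) d = a *: pull_st Z u d + pull_st Z v d.
Proof.
elim/cls_ind: u => f; elim/cls_ind: v => g.
rewrite -[a *: _ + _](linearP (qclass (in_ideal (ideal_P E) X Y))).
by rewrite [pull_st _ _ _]pull_stE !pull_stE pull_lin.
Qed.

Lemma push_bar_lin (Z X Y : C) (d : E Z X) a (u v : qHom (ideal_I E) X Y) :
  push_bar Z (a *: u + v) d = a *: push_bar Z u d + push_bar Z v d.
Proof.
elim/cls_ind: u => f; elim/cls_ind: v => g.
rewrite -[a *: _ + _](linearP (qclass (in_ideal (ideal_I E) X Y))).
by rewrite [push_bar _ _ _]push_barE !push_barE push_lin.
Qed.

Lemma cls_P_eq0 (X Y : C) (u : qHom (ideal_P E) X Y) :
  (forall Z (d : E Y Z), pull_st Z u d = 0) -> u = 0.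
Proof.
elim/cls_ind: u => f f0; rewrite -[RHS](linear0 (qclass (in_ideal (ideal_P E) X Y))).
apply/clsP; rewrite subr0; apply/proj_trivialP => Z d.
by rewrite -pull_stE.
Qed.

Lemma cls_I_eq0 (X Y : C) (u : qHom (ideal_I E) X Y) :
  (forall Z (d : E Z X), push_bar Z u d = 0) -> u = 0.
Proof.
elim/cls_ind: u => f f0; rewrite -[RHS](linear0 (qclass (in_ideal (ideal_I E) X Y))).
apply/clsP; rewrite subr0; apply/inj_trivialP => Z d.
by rewrite -push_barE.
Qed.

Section Right.
Variables (X : C) (R : rep_r E kc X).
Let Y := rep_r_ob R.

(** By the Yoneda lemma, [phi R] amounts to this linear form; it is the form that
    defines the Auslander-Reiten pairing of stable morphisms with extensions. *)
Definition rep_r_elt : dual kc (E X Y) := phi R Y (cls _ (idm Y)).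

Lemma phi_elt Z (u : qHom (ideal_I E) Z Y) :
  phi R Z u = dual_map (push_bar X u) rep_r_elt.
Proof. by rewrite -phi_nat qcomp1m. Qed.

Lemma rep_r_onto Z (f : {linear E X Z -> kc}) :
  exists u : qHom (ideal_I E) Z Y, forall d, f d = rep_r_elt (push_bar X u d).
Proof.
have [g _ gK] := phi_bij R Z; exists (g f) => d.
by rewrite -[in LHS](gK f) phi_elt.
Qed.

(** Realise [d] by [Y -> V_1 -> ...] and call [i] the first map. If [d] is orthogonal to
    all morphisms, the representing form vanishes on the kernel of [i_*], which
    consists of the pull-backs of [d]; so it extends along [i_*] to a form on
    [E (X, V_1)]. The morphism [u : V_1 -> Y] that represents the extension satisfies
    [u i = 1] in the costable category. Hence [d = u_* i_* d = 0]. *)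
Lemma rep_r_pairing_nondeg Z (d : E Z Y) :
  (forall u : qHom (ideal_P E) X Z, rep_r_elt (pull_st Y u d) = 0) -> d = 0.
Proof.
move=> d0; have [V dV] := realized s d.
have [|||b bE] := @injective_factor _ kc _ _ (push E (first_diff V)) rep_r_elt injQ.
- exact: finE.
- exact: finE.
- by move=> x /(push_exact exaC n_gt0 dV)[f ->]; rewrite -pull_stE.
have [u uE] := rep_r_onto b.
have uV : qcomp u (cls _ (first_diff V)) = cls _ (idm Y).
  apply: (bij_inj (phi_bij R Y)); apply: dualP => x.
  by rewrite phi_elt /= push_bar_comp push_barE -uE bE.
rewrite -[d]push1 -push_barE -uV push_bar_comp push_barE.
by rewrite (push_first_diff dV) linear0.
Qed.

(** The second half of Auslander-Reiten duality. A class [u] orthogonal to all extensions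
    acts as zero on extensions, because all forms on [E (X, W)] come from the
    representing one; so [u] is zero. Surjectivity is nondegeneracy on the other side,
    by Matlis duality. *)
Lemma rep_r_pairing_bij Z :
  bijective (fun u : qHom (ideal_P E) X Z => dual_map (pull_st Y u) rep_r_elt).
Proof.
have [|B BE] := @linear_map_exists k (qHom (ideal_P E) X Z) (dual kc (E Z Y))
    (fun u => dual_map (pull_st Y u) rep_r_elt).
  by move=> a u v; apply: dualP => d /=; rewrite pull_st_lin linearP.
apply: surj_bijective => [u v uv|f].
  apply/eqP; rewrite -subr_eq0; apply/eqP/cls_P_eq0 => W d.
  apply: contrapT => /(cogenerator_separates cogenQ (finE _ _))[h]; apply.
  have [w ->] := rep_r_onto h; rewrite -pull_push_q.
  have := BE (u - v); rewrite linearB !BE uv subrr.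
  by move=> /(congr1 (fun g : dual kc (E Z Y) => g (push_bar Z w d))).
have [|u uE] := pairing_perfect artk kc_min (B := B) (finE _ _) _ f.
  by move=> d d0; apply: rep_r_pairing_nondeg => u; rewrite -[RHS](d0 u) BE.
by exists u; rewrite -BE.
Qed.

Lemma rep_r_in_Cl : in_Cl E kc Y.
Proof.
have lin_z Z : exists z : {linear qHom (ideal_P E) X Z -> dual kc (E Z Y)},
    forall u, z u = dual_map (pull_st Y u) rep_r_elt.
  apply: linear_map_exists => a u v; apply: dualP => d /=.
  by rewrite pull_st_lin linearP.
pose z Z := sval (cid (lin_z Z)).
have zE Z u : z Z u = dual_map (pull_st Y u) rep_r_elt by rewrite /z; case: cid.
constructor; apply: (@RepL _ _ _ _ Y X z) => [Z|Z Z' g u].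
  by apply: eq_bij (rep_r_pairing_bij Z) _ _ => u; rewrite zE.
by rewrite !zE; apply: dualP => d /=; rewrite pull_st_comp.
Qed.

End Right.

Section Left.
Variables (Y : C) (L : rep_l E kc Y).
Let X := rep_l_ob L.

Definition rep_l_elt : dual kc (E X Y) := psi L X (cls _ (idm X)).

Lemma psi_elt Z (u : qHom (ideal_P E) X Z) :
  psi L Z u = dual_map (pull_st Y u) rep_l_elt.
Proof. by rewrite -psi_nat qcompm1. Qed.

Lemma rep_l_onto Z (f : {linear E Z Y -> kc}) :
  exists u : qHom (ideal_P E) X Z, forall d, f d = rep_l_elt (pull_st Y u d).
Proof.
have [g _ gK] := psi_bij L Z; exists (g f) => d.
by rewrite -[in LHS](gK f) psi_elt.
Qed.

(** Dually, with the last map [V_n -> X] of a realisation of [d], which becomes a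
    split epimorphism in the stable category. *)
Lemma rep_l_pairing_nondeg Z (d : E X Z) :
  (forall u : qHom (ideal_I E) Z Y, rep_l_elt (push_bar X u d) = 0) -> d = 0.
Proof.
move=> d0; have [V dV] := realized s d.
have [|||b bE] := @injective_factor _ kc _ _ (pull E (last_diff V)) rep_l_elt injQ.
- exact: finE.
- exact: finE.
- by move=> x /(pull_exact exaC dV)[f ->]; rewrite -push_barE.
have [u uE] := rep_l_onto b.
have uV : qcomp (cls _ (last_diff V)) u = cls _ (idm X).
  apply: (bij_inj (psi_bij L X)); apply: dualP => x.
  by rewrite psi_elt /= pull_st_comp pull_stE -uE bE.
rewrite -[d]pull1 -pull_stE -uV pull_st_comp pull_stE.
by rewrite (pull_last_diff dV) linear0.
Qed.

Lemma rep_l_pairing_bij Z :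
  bijective (fun u : qHom (ideal_I E) Z Y => dual_map (push_bar X u) rep_l_elt).
Proof.
have [|B BE] := @linear_map_exists k (qHom (ideal_I E) Z Y) (dual kc (E X Z))
    (fun u => dual_map (push_bar X u) rep_l_elt).
  by move=> a u v; apply: dualP => d /=; rewrite push_bar_lin linearP.
apply: surj_bijective => [u v uv|f].
  apply/eqP; rewrite -subr_eq0; apply/eqP/cls_I_eq0 => W d.
  apply: contrapT => /(cogenerator_separates cogenQ (finE _ _))[h]; apply.
  have [w ->] := rep_l_onto h; rewrite pull_push_q.
  have := BE (u - v); rewrite linearB !BE uv subrr.
  by move=> /(congr1 (fun g : dual kc (E X Z) => g (pull_st Z w d))).
have [|u uE] := pairing_perfect artk kc_min (B := B) (finE _ _) _ f.
  by move=> d d0; apply: rep_l_pairing_nondeg => u; rewrite -[RHS](d0 u) BE.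
by exists u; rewrite -BE.
Qed.

Lemma rep_l_in_Cr : in_Cr E kc X.
Proof.
have lin_z Z : exists z : {linear qHom (ideal_I E) Z Y -> dual kc (E X Z)},
    forall u, z u = dual_map (push_bar X u) rep_l_elt.
  apply: linear_map_exists => a u v; apply: dualP => d /=.
  by rewrite push_bar_lin linearP.
pose z Z := sval (cid (lin_z Z)).
have zE Z u : z Z u = dual_map (push_bar X u) rep_l_elt by rewrite /z; case: cid.
constructor; apply: (@RepR _ _ _ _ X Y z) => [Z|Z Z' g u].
  by apply: eq_bij (rep_l_pairing_bij Z) _ _ => u; rewrite zE.
by rewrite !zE; apply: dualP => d /=; rewrite push_bar_comp.
Qed.

End Left.

(** * The two functors are quasi-inverse *)

Section QuasiInverse.
Variable tau : forall X : {X : C | in_Cr E kc X}, rep_r E kc (sval X).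
Variable taum : forall Y : {Y : C | in_Cl E kc Y}, rep_l E kc (sval Y).

(** Uniqueness of representing objects: [X] with its element [x] and the object of [L]
    represent the same functor. *)
Lemma rep_l_iso (Y : C) (L : rep_l E kc Y) (X : C) (x : dual kc (E X Y))
    (u : qHom (ideal_P E) (rep_l_ob L) X) :
  (forall Z, bijective (fun v : qHom (ideal_P E) X Z => dual_map (pull_st Y v) x)) ->
  psi L X u = x -> @cat_iso (stable E) _ _ u.
Proof.
move=> bij_x ux.
have psi_u Z (v : qHom (ideal_P E) X Z) :
    psi L Z (qcomp v u) = dual_map (pull_st Y v) x by rewrite psi_nat ux.
have [g _ gK] := bij_x (rep_l_ob L).
pose v := g (psi L _ (cls _ (idm _))).
have vu : qcomp v u = cls _ (idm _).
  by apply: (bij_inj (psi_bij L _)); rewrite psi_u gK.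
exists v; split=> //; apply: (bij_inj (bij_x X)); rewrite /= -!psi_u.
congr (psi L X _); rewrite -qcompA vu.
by rewrite qcompm1 qcomp1m.
Qed.

Lemma rep_r_iso (X : C) (R : rep_r E kc X) (Y : C) (y : dual kc (E X Y))
    (u : qHom (ideal_I E) Y (rep_r_ob R)) :
  (forall Z, bijective (fun v : qHom (ideal_I E) Z Y => dual_map (push_bar X v) y)) ->
  phi R Y u = y -> @cat_iso (costable E) _ _ u.
Proof.
move=> bij_y uy.
have phi_u Z (v : qHom (ideal_I E) Z Y) :
    phi R Z (qcomp u v) = dual_map (push_bar X v) y by rewrite phi_nat uy.
have [g _ gK] := bij_y (rep_r_ob R).
pose v := g (phi R _ (cls _ (idm _))).
have uv : qcomp u v = cls _ (idm _).
  by apply: (bij_inj (phi_bij R _)); rewrite phi_u gK.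
exists v; split=> //; apply: (bij_inj (bij_y Y)); rewrite /= -!phi_u.
congr (phi R Y _); rewrite qcompA uv.
by rewrite qcomp1m qcompm1.
Qed.

Variables (tau_Cl : forall X, in_Cl E kc (rep_r_ob (tau X)))
          (taum_Cr : forall Y, in_Cr E kc (rep_l_ob (taum Y))).

Let T := tau_functor tau_Cl.
Let Tm := taum_functor taum_Cr.

(** Both [X] and [taum (tau X)] represent the functor [D E (-, tau X)] on the stable
    category; the resulting isomorphism is natural because [tau f] is adjoint to [f]
    for the two pairings. *)
Lemma taum_tau_id : nat_isomorphic (functor_comp Tm T) (functor_id _).
Proof.
have eta_ex (X : obj (stable_Cr E kc)) : {u : qHom (ideal_P E) (sval (Tm (T X))) (sval X)
    | psi (taum (T X)) (sval X) u = rep_r_elt (tau X)}.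
  apply: cid; have [g _ gK] := psi_bij (taum (T X)) (sval X).
  by exists (g (rep_r_elt (tau X))).
exists (fun X => sval (eta_ex X)); split=> [X|X M f].
  apply: iso_full_sub; apply: rep_l_iso (svalP (eta_ex X)) => Z.
  exact: rep_r_pairing_bij.
apply: (bij_inj (psi_bij (taum (T X)) (sval M))).
rewrite [LHS](taum_morE (taum := taum)) (svalP (eta_ex M)) [RHS]psi_nat (svalP (eta_ex X)).
rewrite -[LHS](phi_elt (R := tau M)) -[RHS](tau_morE (tau := tau) f (cls _ (idm _))).
by congr (phi _ _ _); exact/esym/qcompm1.
Qed.

Lemma tau_taum_id : nat_isomorphic (functor_comp T Tm) (functor_id _).
Proof.
apply: nat_isomorphic_sym.
have eta_ex (Y : obj (costable_Cl E kc)) : {u : qHom (ideal_I E) (sval Y) (sval (T (Tm Y)))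
    | phi (tau (Tm Y)) (sval Y) u = rep_l_elt (taum Y)}.
  apply: cid; have [g _ gK] := phi_bij (tau (Tm Y)) (sval Y).
  by exists (g (rep_l_elt (taum Y))).
exists (fun Y => sval (eta_ex Y)); split=> [Y|Y N g].
  apply: iso_full_sub; apply: rep_r_iso (svalP (eta_ex Y)) => Z.
  exact: rep_l_pairing_bij.
apply: (bij_inj (phi_bij (tau (Tm N)) (sval Y))).
rewrite [LHS]phi_nat (svalP (eta_ex N)) [RHS](tau_morE (tau := tau)) (svalP (eta_ex Y)).
rewrite -[LHS](taum_morE (taum := taum) g (cls _ (idm _))) -[RHS](psi_elt (L := taum Y)).
by congr (psi _ _ _); exact/qcomp1m.
Qed.

End QuasiInverse.

End AuslanderReitenDuality.

Theorem theorem3p10 (k : comPzRingType) (k_artinian : artinian k)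
    (kc : lmodType k) (kc_min : minimal_inj_cogenerator kc)
    (n : nat) (n_ge1 : (1 <= n)%N)
    (C : linCat k) (E : bifunctor C) (s : exact_realization E n)
    (C_exangulated : n_exangulated s)
    (C_Ext_finite : Ext_finite E)
    (C_krull_schmidt : krull_schmidt C)
    (tau : forall X : {X : C | in_Cr E kc X}, rep_r E kc (sval X))
    (taum : forall Y : {Y : C | in_Cl E kc Y}, rep_l E kc (sval Y)) :
  exists (tau_Cl : forall X, in_Cl E kc (rep_r_ob (tau X)))
         (taum_Cr : forall Y, in_Cr E kc (rep_l_ob (taum Y))),
    [/\ equivalence (tau_functor tau_Cl),
        equivalence (taum_functor taum_Cr)
      & quasi_inverse (tau_functor tau_Cl) (taum_functor taum_Cr)].
Proof.
have tau_Cl X : in_Cl E kc (rep_r_ob (tau X)).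
  exact: (rep_r_in_Cl k_artinian kc_min n_ge1 C_exangulated C_Ext_finite).
have taum_Cr Y : in_Cr E kc (rep_l_ob (taum Y)).
  exact: (rep_l_in_Cr k_artinian kc_min C_exangulated C_Ext_finite).
have taum_tau := taum_tau_id k_artinian kc_min n_ge1 C_exangulated C_Ext_finite
  tau_Cl taum_Cr.
have tau_taum := tau_taum_id k_artinian kc_min C_exangulated C_Ext_finite
  tau_Cl taum_Cr.
exists tau_Cl, taum_Cr; split=> //.
  by exists (taum_functor taum_Cr).
by exists (tau_functor tau_Cl).
Qed.
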